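(* There is a natural, discriminant preserving bijection between the set of $\mathrm{GL}_2(\mathbb{Z})$-equivalence classes of binary quartic forms with integer coefficients and the set of isomorphism classes of pairs $(Q,C)$ where $Q$ is a quartic ring and $C$ is a monogenized cubic resolvent of $Q$ (a cubic resolvent of $Q$ together with a chosen generator modulo $\mathbb{Z}$, isomorphisms being required to preserve the chosen generator of $C$ modulo $\mathbb{Z}$). Explicitly, the map sending a binary quartic form $f$ to the pair $(R_f,C_f)$ constructed in the context, where $C_f$ is monogenized by $\omega$, induces this bijection, and $\mathrm{Disc}(f)=\mathrm{Disc}(R_f)=\mathrm{Disc}(C_f)$.
   Context: **Rings.** An $n$-ic ring is a commutative ring with unit isomorphic to $\mathbb{Z}^n$ as a $\mathbb{Z}$-module (cubic: $n=3$; quartic: $n=4$). Its discriminant is $\det(\mathrm{Tr}(\zeta_i\zeta_j))$ for any $\mathbb{Z}$-basis $(\zeta_i)$, where $\mathrm{Tr}(r)$ is the trace of multiplication by $r$. $R/\mathbb{Z}$ denotes the quotient of the additive group of $R$ by $\mathbb{Z}\cdot 1$. **Binary quartic forms.** A binary quartic form is $f=f_0x^4+f_1x^3y+f_2x^2y^2+f_3xy^3+f_4y^4$ with $f_i\in\mathbb{Z}$ (all $f_i=0$ allowed). The group $\mathrm{GL}_2(\mathbb{Z})$ acts by $\left(\begin{smallmatrix}a&b\\c&d\end{smallmatrix}\right)\circ f(x,y)=f(ax+cy,bx+dy)$. $\mathrm{Disc}(f)$ is the usual discriminant of a binary quartic form. **Quartic ring of $f$.** $R_f$ is the quartic ring with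 $\mathbb{Z}$-basis $1,\zeta_1,\zeta_2,\zeta_3'$ and commutative multiplication $\zeta_1^2=-f_1\zeta_1+f_0\zeta_2$, $\zeta_1\zeta_2=-f_2\zeta_1+f_0\zeta_3'-f_0f_3$, $\zeta_1\zeta_3'=-f_0f_4$, $\zeta_2^2=-f_3\zeta_1-f_2\zeta_2+f_1\zeta_3'-f_1f_3-f_0f_4$, $\zeta_2\zeta_3'=-f_4\zeta_1-f_1f_4$, $(\zeta_3')^2=-f_4\zeta_2+f_3\zeta_3'-f_2f_4$. **Cubic rings and binary cubic forms.** Given a cubic ring $C$ and a $\mathbb{Z}$-basis $\omega,\theta$ of $C/\mathbb{Z}$, there are unique lifts of $\omega,\theta$ to $C$ with $\omega\theta\in\mathbb{Z}$, and a unique integral binary cubic form $ax^3+bx^2y+cxy^2+dy^3$ such that $\omega\theta=-ad$, $\omega^2=-ac+b\omega-a\theta$, $\theta^2=-bd+d\omega-c\theta$. This is the binary cubic form associated to $(C,\omega,\theta)$, and every integral binary cubic form arises from a unique such based cubic ring. **Cubic resolvents.** A quadratic map $\phi:Q/\mathbb{Z}\to C/\mathbb{Z}$ is a map with $\phi(ax)=a^2\phi(x)$ for $a\in\mathbb{Z}$ such that $\phi(x+y)-\phi(x)-\phi(y)$ is bilinear. A cubic resolvent of a quartic ring $Q$ is a cubic ring $C$ together with a quadratic map $\phi:Q/\mathbb{Z}\to C/\mathbb{Z}$ and an isomorphism $\delta:\wedge^4Q\cong\wedge^3C$ (equivalently $\bar\delta:\wedge^3(Q/\mathbb{Z})\cong\wedge^2(C/\mathbb{Z})$)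 such that (1) $\delta(1\wedge x\wedge y\wedge xy)=1\wedge\phi(x)\wedge\phi(y)$ for all $x,y\in Q$; and (2) the binary cubic form in $\mathrm{Sym}^3(C/\mathbb{Z})^*\otimes\wedge^2(C/\mathbb{Z})$ corresponding to $C$ is $\mathrm{Det}(\phi)$. Concretely, (2) means: for one (equivalently, any) choice of bases $\alpha_1,\alpha_2,\alpha_3$ of $Q/\mathbb{Z}$ and $\omega,\theta$ of $C/\mathbb{Z}$ with $\bar\delta(\alpha_1\wedge\alpha_2\wedge\alpha_3)=\omega\wedge\theta$, writing $\phi(\sum t_i\alpha_i)=B(t)\omega+A(t)\theta$ with integral ternary quadratic forms $A,B$ identified with their symmetric (half-integral off the diagonal) matrices, the form $4\,\mathrm{Det}(Ax-By)$ is the binary cubic form associated to $(C,\omega,\theta)$. **Monogenized resolvents and isomorphisms.** A cubic ring is monogenic if it is generated by one element as a $\mathbb{Z}$-algebra. A monogenized cubic ring is a cubic ring $C$ with a chosen $\omega\in C/\mathbb{Z}$ such that $C=\mathbb{Z}[\omega]$. An isomorphism of pairs $(Q,C)\to(Q',C')$ consists of ring isomorphisms $Q\cong Q'$, $C\cong C'$ commuting with the quadratic maps $\phi,\phi'$ and such that the induced map $C/\mathbb{Z}\to C'/\mathbb{Z}$ takes the chosen generator to the chosen generator. **Resolvent attached to $f$.** Put $$A_0=\begin{pmatrix}0&-\tfrac12&0\\-\tfrac12&0&0\\0&0&1\end{pmatrix},\qquad B_f=\begin{pmatrix}f_4&0&\tfrac{f_3}{2}\\0&f_0&\tfrac{f_1}{2}\\\tfrac{f_3}{2}&\tfrac{f_1}{2}&f_2\end{pmatrix}.$$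 $C_f$ is the based cubic ring with basis $\omega,\theta$ of $C_f/\mathbb{Z}$ associated to the binary cubic form $4\,\mathrm{Det}(A_0x-B_fy)$ (which has $x^3$-coefficient $-1$, so $C_f=\mathbb{Z}[\omega]$). With $\alpha_1=\zeta_3'$, $\alpha_2=\zeta_1$, $\alpha_3=\zeta_2$ as basis of $R_f/\mathbb{Z}$, the resolvent structure is $\phi(\sum t_i\alpha_i)=B_f(t)\omega+A_0(t)\theta$ and $\bar\delta(\alpha_1\wedge\alpha_2\wedge\alpha_3)=\omega\wedge\theta$. *)

(* Defs.v *)
From HB Require Import structures.
From mathcomp Require Import all_boot all_order all_algebra all_fingroup.
From mathcomp Require Import generic_quotient ring_quotient.
From mathcomp Require Import boolp classical_sets functions.
From mathcomp.multinomials Require Import freeg.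
From mathcomp Require Import ssrAC ring.

Set Implicit Arguments.
Unset Strict Implicit.
Unset Printing Implicit Defensive.

Import Order.TTheory GRing.Theory Num.Theory.

Local Open Scope ring_scope.
Local Open Scope quotient_scope.
Local Open Scope classical_set_scope.

Definition zlincomb (n : nat) (M : zmodType) (e : n.-tuple M) (c : 'rV[int]_n) : M :=
  \sum_(i < n) tnth e i *~ c 0 i.

Definition zbasis (n : nat) (M : zmodType) (e : n.-tuple M) : Prop :=
  bijective (zlincomb e).

Definition nic_ring (n : nat) (R : comNzRingType) : Prop :=
  exists h : {additive R -> 'rV[int]_n}, bijective h.

Definition zcoord (n : nat) (M : zmodType) (e : n.-tuple M) (x : M) : 'rV[int]_n :=
  xget 0 [set c | zlincomb e c = x].

Definition mul_trace (n : nat) (R : comNzRingType) (e : n.-tuple R) (r : R) : int :=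
  \tr (\matrix_(i < n, j < n) zcoord e (r * tnth e i) 0 j).

Definition basis_disc (n : nat) (R : comNzRingType) (e : n.-tuple R) : int :=
  \det (\matrix_(i < n, j < n) mul_trace e (tnth e i * tnth e j)).

(* The determinant does not depend on the basis, so any Z-basis may be chosen. *)
Definition ring_disc (n : nat) (R : comNzRingType) : int :=
  basis_disc (xget (nseq_tuple n 0) [set e : n.-tuple R | zbasis e]).

Definition Zone (R : comNzRingType) : {pred R} :=
  fun x => `[< exists n : int, x = n%:~R >].

Lemma Zone_zmod_closed (R : comNzRingType) : zmod_closed (@Zone R).
Proof.
split=> [|x y /asboolP[m ->] /asboolP[n ->]]; apply/asboolP.
  by exists 0.
by exists (m - n); rewrite rmorphB.
Qed.

HB.instance Definition _ (R : comNzRingType) :=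
  GRing.isZmodClosed.Build R (@Zone R) (@Zone_zmod_closed R).

Definition modZ (R : comNzRingType) : Type := Quotient.quot (@Zone R).

HB.instance Definition _ (R : comNzRingType) := GRing.Zmodule.on (modZ R).
HB.instance Definition _ (R : comNzRingType) :=
  ZmodQuotient.on (modZ R).

Definition modZ_map (R S : comNzRingType) (h : R -> S) (x : modZ R) : modZ S :=
  \pi_(modZ S) (h (repr x)).

Section ExteriorPower.
Variables (n : nat) (M : zmodType).
Local Notation free := {freeg (n.-tuple M) / int}.

Definition fgen (x : n.-tuple M) : free := Freeg [:: (1, x)].

Definition tset (x : n.-tuple M) (i : 'I_n) (a : M) : n.-tuple M :=
  [tuple if j == i then a else tnth x j | j < n].

Inductive ext_relation : free -> Prop :=
| ext_rel0 : ext_relation 0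
| ext_relB u v : ext_relation u -> ext_relation v -> ext_relation (u - v)
| ext_rel_add x i a b :
    ext_relation (fgen (tset x i (a + b)) - fgen (tset x i a) - fgen (tset x i b))
| ext_rel_alt x i j : i != j -> tnth x i = tnth x j -> ext_relation (fgen x).

Definition ext_kernel : {pred free} := fun u => `[< ext_relation u >].

Lemma ext_kernel_zmod_closed : zmod_closed ext_kernel.
Proof.
split=> [|u v /asboolP hu /asboolP hv]; apply/asboolP; first exact: ext_rel0.
exact: ext_relB.
Qed.

HB.instance Definition _ :=
  GRing.isZmodClosed.Build free ext_kernel ext_kernel_zmod_closed.

End ExteriorPower.

Definition extpow (n : nat) (M : zmodType) : Type := Quotient.quot (@ext_kernel n M).

HB.instance Definition _ (n : nat) (M : zmodType) := GRing.Zmodule.on (extpow n M).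
HB.instance Definition _ (n : nat) (M : zmodType) :=
  ZmodQuotient.on (extpow n M).

Definition wedge (n : nat) (M : zmodType) (x : n.-tuple M) : extpow n M :=
  \pi_(extpow n M) (fgen x).

Record bqf : Type := BQF { f0 : int; f1 : int; f2 : int; f3 : int; f4 : int }.

Definition bqf_eval (K : comNzRingType) (f : bqf) (x y : K) : K :=
  (f0 f)%:~R * x ^+ 4 + (f1 f)%:~R * x ^+ 3 * y + (f2 f)%:~R * x ^+ 2 * y ^+ 2
  + (f3 f)%:~R * x * y ^+ 3 + (f4 f)%:~R * y ^+ 4.

Definition bqf_disc (f : bqf) : int :=
  let a := f0 f in let b := f1 f in let c := f2 f in let d := f3 f in let e := f4 f in
  256 * a ^+ 3 * e ^+ 3 - 192 * a ^+ 2 * b * d * e ^+ 2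
  - 128 * a ^+ 2 * c ^+ 2 * e ^+ 2 + 144 * a ^+ 2 * c * d ^+ 2 * e
  - 27 * a ^+ 2 * d ^+ 4 + 144 * a * b ^+ 2 * c * e ^+ 2
  - 6 * a * b ^+ 2 * d ^+ 2 * e - 80 * a * b * c ^+ 2 * d * e
  + 18 * a * b * c * d ^+ 3 + 16 * a * c ^+ 4 * e - 4 * a * c ^+ 3 * d ^+ 2
  - 27 * b ^+ 4 * e ^+ 2 + 18 * b ^+ 3 * c * d * e - 4 * b ^+ 3 * d ^+ 3
  - 4 * b ^+ 2 * c ^+ 3 * e + b ^+ 2 * c ^+ 2 * d ^+ 2.

(* Z[x, y] is realized as {poly {poly int}}. *)
Definition gl2_equiv (f g : bqf) : Prop :=
  exists2 m : 'M[int]_2, m \in unitmx &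
    let x : {poly {poly int}} := 'X in let y : {poly {poly int}} := ('X)%:P in
    bqf_eval g x y =
    bqf_eval f ((m 0 0)%:~R * x + (m 1 0)%:~R * y) ((m 0 1)%:~R * x + (m 1 1)%:~R * y).

Record bcf : Type := BCF { ca : int; cb : int; cc : int; cd : int }.

Definition bcf_eval (K : comNzRingType) (g : bcf) (x y : K) : K :=
  (ca g)%:~R * x ^+ 3 + (cb g)%:~R * x ^+ 2 * y + (cc g)%:~R * x * y ^+ 2
  + (cd g)%:~R * y ^+ 3.

(* q11 t1^2 + q22 t2^2 + q33 t3^2 + q12 t1 t2 + q13 t1 t3 + q23 t2 t3 *)
Record tqf : Type := TQF
  { q11 : int; q22 : int; q33 : int; q12 : int; q13 : int; q23 : int }.

Definition tqf_eval (q : tqf) (t : 'rV[int]_3) : int :=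
  let t1 := t 0 0 in let t2 := t 0 1 in let t3 := t 0 2 in
  q11 q * t1 ^+ 2 + q22 q * t2 ^+ 2 + q33 q * t3 ^+ 2
  + q12 q * (t1 * t2) + q13 q * (t1 * t3) + q23 q * (t2 * t3).

Definition mx3 (K : Type) (x0 : K) (s : seq (seq K)) : 'M[K]_3 :=
  \matrix_(i < 3, j < 3) nth x0 (nth [::] s i) j.

Definition tqf_mx (q : tqf) : 'M[rat]_3 :=
  let z (n : int) : rat := n%:~R in
  mx3 0 [:: [:: z (q11 q)    ; z (q12 q) / 2; z (q13 q) / 2];
            [:: z (q12 q) / 2; z (q22 q)    ; z (q23 q) / 2];
            [:: z (q13 q) / 2; z (q23 q) / 2; z (q33 q)    ]].

(* 4 Det(A x - B y) as an element of Q[x, y] = {poly {poly rat}}. *)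
Definition four_det (A B : tqf) : {poly {poly rat}} :=
  4 * \det ('X *: map_mx (fun r : rat => r%:P%:P) (tqf_mx A)
            - ('X)%:P *: map_mx (fun r : rat => r%:P%:P) (tqf_mx B)).

Definition quadratic_map (M N : zmodType) (phi : M -> N) : Prop :=
  let b x y := phi (x + y) - phi x - phi y in
  [/\ forall (a : int) x, phi (x *~ a) = phi x *~ (a ^+ 2),
      forall x x' y, b (x + x') y = b x y + b x' y
    & forall x y y', b x (y + y') = b x y + b x y'].

Definition associated_cubic_form (C : comNzRingType) (omega theta : modZ C)
    (g : bcf) : Prop :=
  let a := ca g in let b := cb g in let c := cc g in let d := cd g in
  exists w t : C,
    [/\ \pi_(modZ C) w = omega, \pi_(modZ C) t = theta,
        w * t = (- (a * d))%:~R,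
        w ^+ 2 = (- (a * c))%:~R + w *~ b - t *~ a
      & t ^+ 2 = (- (b * d))%:~R + w *~ d - t *~ c].

(* Since 1 /\ 1 = 0, the element 1 /\ repr x1 /\ ... /\ repr xn depends only on
   the classes xi: this is the isomorphism of /\^n (R/Z) with /\^(n+1) R. *)
Definition wedge1 (n : nat) (R : comNzRingType) (x : n.-tuple (modZ R)) :
    extpow n.+1 R :=
  wedge [tuple of 1 :: [seq repr z | z <- x]].

Definition resolvent_form_condition (Q C : comNzRingType) (phi : modZ Q -> modZ C)
    (delta : extpow 4 Q -> extpow 3 C) : Prop :=
  exists (alpha : 3.-tuple (modZ Q)) (omega theta : modZ C) (A B : tqf) (g : bcf),
    (zbasis alpha /\ zbasis [tuple omega; theta]) /\
    [/\ delta (wedge1 alpha) = wedge1 [tuple omega; theta],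
        forall t, phi (zlincomb alpha t) = omega *~ tqf_eval B t + theta *~ tqf_eval A t,
        four_det A B = bcf_eval g 'X ('X)%:P
      & associated_cubic_form omega theta g].

Record cubic_resolvent (Q : comNzRingType) : Type := CubicResolvent {
  res_ring : comNzRingType;
  res_cubic : nic_ring 3 res_ring;
  res_phi : modZ Q -> modZ res_ring;
  res_phi_quadratic : quadratic_map res_phi;
  res_delta : {additive extpow 4 Q -> extpow 3 res_ring};
  res_delta_iso : bijective res_delta;
  res_delta_phi : forall x y : Q,
    res_delta (wedge [tuple 1; x; y; x * y]) =
    wedge1 [tuple res_phi (\pi_(modZ Q) x); res_phi (\pi_(modZ Q) y)];
  res_form : resolvent_form_condition res_phi res_delta
}.

(* Z[omega] is the same for all lifts of omega. *)
Definition monogenized_by (C : comNzRingType) (omega : modZ C) : Prop :=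
  forall c : C, exists p : {poly int}, c = (map_poly intr p).[repr omega].

Record monogenized_pair : Type := MonogenizedPair {
  mp_quartic : comNzRingType;
  mp_quarticP : nic_ring 4 mp_quartic;
  mp_res : cubic_resolvent mp_quartic;
  mp_gen : modZ (res_ring mp_res);
  mp_genP : monogenized_by mp_gen
}.

Definition mp_cubic (P : monogenized_pair) : comNzRingType := res_ring (mp_res P).

Definition mp_iso (P P' : monogenized_pair) : Prop :=
  exists (g : {rmorphism mp_quartic P -> mp_quartic P'})
         (h : {rmorphism mp_cubic P -> mp_cubic P'}),
    [/\ bijective g, bijective h,
        forall x, modZ_map h (res_phi (mp_res P) x) = res_phi (mp_res P') (modZ_map g x)
      & modZ_map h (mp_gen P) = mp_gen P'].

Definition quartic_ring (f : bqf) : Type := (int * int * int * int)%type.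

Section QuarticRing.
Variable f : bqf.
Local Notation R := (quartic_ring f).
Local Notation f0 := (f0 f).
Local Notation f1 := (f1 f).
Local Notation f2 := (f2 f).
Local Notation f3 := (f3 f).
Local Notation f4 := (f4 f).

(* (r, r1, r2, r3) stands for r + r1 zeta1 + r2 zeta2 + r3 zeta3'. *)
Definition qr_one : R := (1, 0, 0, 0).
Definition qr_mul (r s : R) : R :=
  let: (r0, r1, r2, r3) := r in let: (s0, s1, s2, s3) := s in
  let p11 := r1 * s1 in let p22 := r2 * s2 in let p33 := r3 * s3 in
  let p12 := r1 * s2 + r2 * s1 in let p13 := r1 * s3 + r3 * s1 in
  let p23 := r2 * s3 + r3 * s2 in
  (r0 * s0 - p12 * (f0 * f3) - p13 * (f0 * f4) - p22 * (f1 * f3 + f0 * f4)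
     - p23 * (f1 * f4) - p33 * (f2 * f4),
   r0 * s1 + r1 * s0 - p11 * f1 - p12 * f2 - p22 * f3 - p23 * f4,
   r0 * s2 + r2 * s0 + p11 * f0 - p22 * f2 - p33 * f4,
   r0 * s3 + r3 * s0 + p12 * f0 + p22 * f1 + p33 * f3).

HB.instance Definition _ := GRing.Zmodule.on R.

Lemma qr_mulA : associative qr_mul.
Proof.
move=> [[[r0 r1] r2] r3] [[[s0 s1] s2] s3] [[[t0 t1] t2] t3] /=.
by congr (_, _, _, _); ring.
Qed.

Lemma qr_mulC : commutative qr_mul.
Proof.
move=> [[[r0 r1] r2] r3] [[[s0 s1] s2] s3] /=.
by congr (_, _, _, _); ring.
Qed.

Lemma qr_mul1 : left_id qr_one qr_mul.
Proof.
by move=> [[[s0 s1] s2] s3] /=; congr (_, _, _, _); ring.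
Qed.

Lemma qr_mulDl : left_distributive qr_mul +%R.
Proof.
move=> [[[r0 r1] r2] r3] [[[s0 s1] s2] s3] [[[t0 t1] t2] t3] /=.
by congr (_, _, _, _) => /=; ring.
Qed.

Lemma qr_one_neq0 : qr_one != 0.
Proof. by []. Qed.

HB.instance Definition _ := GRing.Zmodule_isComNzRing.Build R
  qr_mulA qr_mulC qr_mul1 qr_mulDl qr_one_neq0.

Lemma qr_mulz (x : R) (n : int) :
  x *~ n = (x.1.1.1 * n, x.1.1.2 * n, x.1.2 * n, x.2 * n).
Proof.
have h (m : nat) : x *+ m
    = (x.1.1.1 * m%:Z, x.1.1.2 * m%:Z, x.1.2 * m%:Z, x.2 * m%:Z).
  case: x => [[[x0 x1] x2] x3] /=; elim: m => [|m IH]; first by rewrite mulr0n !mulr0.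
  by rewrite mulrS IH; congr (_, _, _, _) => /=; rewrite intS; ring.
case: n => m; first by rewrite -pmulrn h.
by rewrite NegzE mulrNz -pmulrn h; congr (_, _, _, _) => /=; ring.
Qed.

Definition zeta1 : R := (0, 1, 0, 0).
Definition zeta2 : R := (0, 0, 1, 0).
Definition zeta3' : R := (0, 0, 0, 1).

End QuarticRing.

Lemma quartic_ring_table (f : bqf) :
  let z1 := zeta1 f in let z2 := zeta2 f in let z3 := zeta3' f in
  [/\ z1 * z1 = - (z1 *~ f1 f) + z2 *~ f0 f,
      z1 * z2 = - (z1 *~ f2 f) + z3 *~ f0 f - (f0 f * f3 f)%:~R
    & z1 * z3 = - (f0 f * f4 f)%:~R] /\
  [/\ z2 * z2 = - (z1 *~ f3 f) - z2 *~ f2 f + z3 *~ f1 f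
                - (f1 f * f3 f)%:~R - (f0 f * f4 f)%:~R,
      z2 * z3 = - (z1 *~ f4 f) - (f1 f * f4 f)%:~R
    & z3 * z3 = - (z2 *~ f4 f) + z3 *~ f3 f - (f2 f * f4 f)%:~R].
Proof. by split; split; rewrite !qr_mulz; congr (_, _, _, _) => /=; ring.
Qed.

Definition cubic_ring (g : bcf) : Type := (int * int * int)%type.

Section CubicRing.
Variable g : bcf.
Local Notation C := (cubic_ring g).
Local Notation a := (ca g).
Local Notation b := (cb g).
Local Notation c := (cc g).
Local Notation d := (cd g).

(* (r, r1, r2) stands for r + r1 w + r2 t, with w and t the normalized lifts of
   omega and theta, i.e. those with w t in Z. *)
Definition cr_one : C := (1, 0, 0).
Definition cr_mul (r s : C) : C :=
  let: (r0, r1, r2) := r in let: (s0, s1, s2) := s in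
  let p11 := r1 * s1 in let p22 := r2 * s2 in let p12 := r1 * s2 + r2 * s1 in
  (r0 * s0 - p11 * (a * c) - p12 * (a * d) - p22 * (b * d),
   r0 * s1 + r1 * s0 + p11 * b + p22 * d,
   r0 * s2 + r2 * s0 - p11 * a - p22 * c).

HB.instance Definition _ := GRing.Zmodule.on C.

Lemma cr_mulA : associative cr_mul.
Proof.
move=> [[r0 r1] r2] [[s0 s1] s2] [[t0 t1] t2] /=.
by congr (_, _, _); ring.
Qed.

Lemma cr_mulC : commutative cr_mul.
Proof.
by move=> [[r0 r1] r2] [[s0 s1] s2] /=; congr (_, _, _); ring.
Qed.

Lemma cr_mul1 : left_id cr_one cr_mul.
Proof. by move=> [[s0 s1] s2] /=; congr (_, _, _); ring. Qed.

Lemma cr_mulDl : left_distributive cr_mul +%R.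
Proof.
move=> [[r0 r1] r2] [[s0 s1] s2] [[t0 t1] t2] /=.
by congr (_, _, _) => /=; ring.
Qed.

Lemma cr_one_neq0 : cr_one != 0.
Proof. by []. Qed.

HB.instance Definition _ := GRing.Zmodule_isComNzRing.Build C
  cr_mulA cr_mulC cr_mul1 cr_mulDl cr_one_neq0.

Definition cr_omega : modZ C := \pi_(modZ C) (0, 1, 0).
Definition cr_theta : modZ C := \pi_(modZ C) (0, 0, 1).

Lemma cr_mulz (x : C) (n : int) : x *~ n = (x.1.1 * n, x.1.2 * n, x.2 * n).
Proof.
have h (m : nat) : x *+ m = (x.1.1 * m%:Z, x.1.2 * m%:Z, x.2 * m%:Z).
  case: x => [[x0 x1] x2] /=; elim: m => [|m IH]; first by rewrite mulr0n !mulr0.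
  by rewrite mulrS IH; congr (_, _, _) => /=; rewrite intS; ring.
case: n => m; first by rewrite -pmulrn h.
by rewrite NegzE mulrNz -pmulrn h; congr (_, _, _) => /=; ring.
Qed.

Lemma cubic_ring_form : associated_cubic_form cr_omega cr_theta g.
Proof.
exists (0, 1, 0), (0, 0, 1).
by split; rewrite ?cr_mulz //= ?expr2; congr (_, _, _) => /=; ring.
Qed.

End CubicRing.

Section ExteriorTheory.
Variables (n : nat) (M : zmodType).
Implicit Types (x e : n.-tuple M) (G : zmodType).

Lemma ext_piB (u v : {freeg (n.-tuple M) / int}) :
  \pi_(extpow n M) (u - v) = \pi_(extpow n M) u - \pi_(extpow n M) v.
Proof. by rewrite (Quotient.pi_add (@ext_kernel n M)) (Quotient.pi_opp (@ext_kernel n M)). Qed.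

HB.instance Definition _ := GRing.isZmodMorphism.Build _ _ (\pi_(extpow n M)) ext_piB.

Lemma ext_pi0 (u : {freeg (n.-tuple M) / int}) :
  ext_relation u -> \pi_(extpow n M) u = 0.
Proof.
move=> hu; rewrite -(raddf0 (\pi_(extpow n M))); apply/eqP.
by rewrite -(Quotient.idealrBE (@ext_kernel n M)) subr0; apply/asboolP.
Qed.

Definition alternating_map G (D : n.-tuple M -> G) : Prop :=
  (forall x i a b, D (tset x i (a + b)) = D (tset x i a) + D (tset x i b)) /\
  (forall x i j, i != j -> tnth x i = tnth x j -> D x = 0).

Lemma wedge_alternating : alternating_map (@wedge n M).
Proof.
split=> [x i a b | x i j hij hx]; last exact/ext_pi0/(ext_rel_alt hij hx).
have := ext_pi0 (ext_rel_add x i a b); rewrite !raddfB /=.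
by rewrite -addrA -opprD => /subr0_eq.
Qed.

Lemma tnth_tset x i a j : tnth (tset x i a) j = if j == i then a else tnth x j.
Proof. by rewrite tnth_mktuple. Qed.

Lemma tset_id x i : tset x i (tnth x i) = x.
Proof. by apply: eq_from_tnth => j; rewrite tnth_tset; case: eqP => [->|]. Qed.

Lemma tset2 x i a b : tset (tset x i a) i b = tset x i b.
Proof. by apply: eq_from_tnth => j; rewrite !tnth_tset; case: eqP. Qed.

Lemma tsetC x i j a b : i != j -> tset (tset x i a) j b = tset (tset x j b) i a.
Proof.
move=> hij; apply: eq_from_tnth => k; rewrite !tnth_tset.
by case: (eqVneq k j) => // ->; rewrite eq_sym (negPf hij).
Qed.

Lemma ext_ind (P : extpow n M -> Prop) :
  P 0 -> (forall u v, P u -> P v -> P (u - v)) -> (forall x, P (wedge x)) ->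
  forall u, P u.
Proof.
move=> P0 PB Pw u.
have PN v : P v -> P (- v) by move=> hv; rewrite -(add0r (- v)); apply: PB.
have PD v w : P v -> P w -> P (v + w).
  by move=> hv hw; rewrite -(opprK w); apply: PB => //; apply: PN.
rewrite -(reprK u); set r : {freeg _ / _} := repr u.
rewrite -(freeg_sumE r) raddf_sum; apply: (big_ind P) => //= x _.
have -> : << coeff x r *g x >> = fgen x *~ coeff x r :> {freeg (n.-tuple M) / int}.
  by rewrite /fgen freegU_mulz intz.
rewrite raddfMz -/(wedge x).
have h (m : nat) : P (wedge x *+ m).
  by elim: m => [|m IH]; rewrite ?mulr0n // mulrS; apply: PD.
case: (coeff x r) => m; first by rewrite -pmulrn.
by rewrite NegzE mulrNz; apply: PN; rewrite -pmulrn.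
Qed.

Section Alternating.
Variables (G : zmodType) (D : n.-tuple M -> G).
Hypothesis altD : alternating_map D.

Let DD := altD.1.

Lemma alt0 x i : D (tset x i 0) = 0.
Proof. by have /eqP := DD x i 0 0; rewrite addr0 -subr_eq subrr eq_sym => /eqP. Qed.

Lemma altN x i a : D (tset x i (- a)) = - D (tset x i a).
Proof. by apply/eqP; rewrite -addr_eq0 -DD addNr alt0. Qed.

Lemma altMz x i a (k : int) : D (tset x i (a *~ k)) = D (tset x i a) *~ k.
Proof.
have h (m : nat) : D (tset x i (a *+ m)) = D (tset x i a) *+ m.
  by elim: m => [|m IH]; rewrite ?mulr0n ?alt0 // !mulrS DD IH.
case: k => m; first by rewrite -!pmulrn h.
by rewrite NegzE !mulrNz altN -!pmulrn h.
Qed.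

Lemma alt_sum x i (I : Type) (r : seq I) (F : I -> M) :
  D (tset x i (\sum_(k <- r) F k)) = \sum_(k <- r) D (tset x i (F k)).
Proof.
elim: r => [|k r IH]; first by rewrite !big_nil alt0.
by rewrite !big_cons DD IH.
Qed.

Lemma alt_swap x i j : i != j ->
  D (tset (tset x i (tnth x j)) j (tnth x i)) = - D x.
Proof.
move=> hij; have hji : j != i by rewrite eq_sym.
pose y a b := tset (tset x i a) j b.
have y0 a : D (y a a) = 0.
  by apply: (altD.2 _ i j) => //; rewrite !tnth_tset eqxx (negPf hij) eqxx.
have yD1 a a' b : D (y (a + a') b) = D (y a b) + D (y a' b).
  by rewrite /y !(tsetC _ _ _ hij) DD.
have yD2 a b b' : D (y a (b + b')) = D (y a b) + D (y a b') by rewrite /y DD.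
have := y0 (tnth x i + tnth x j).
rewrite yD1 !yD2 !y0 add0r addr0 => /eqP; rewrite addrC addr_eq0 => /eqP.
by rewrite -/(y _ _) => ->; congr (- D _); rewrite /y !tset_id.
Qed.

Lemma alt_perm0 e (s : {perm 'I_n}) : D e = 0 -> D [tuple tnth e (s i) | i < n] = 0.
Proof.
move=> De; case: (prod_tpermP s) => ts -> hts.
elim: ts hts => [_|[i j] ts IH /andP[/= hij hts]].
  rewrite big_nil -[RHS]De; congr D; apply: eq_from_tnth => k.
  by rewrite tnth_mktuple perm1.
rewrite big_cons; set s' := (\prod_(t <- ts) _)%g in IH *.
have {}IH := IH hts; set x := [tuple _ | _ < n] in IH.
have := alt_swap x hij; rewrite IH oppr0 => <-; congr D.
apply: eq_from_tnth => k; rewrite !tnth_tset !tnth_mktuple permM.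
case: tpermP => [->|->|/eqP h1 /eqP h2]; rewrite ?eqxx ?(negPf hij) //.
by rewrite (negPf h1) (negPf h2).
Qed.

Lemma alt_basis0 e : (forall a, exists c, a = zlincomb e c) -> D e = 0 ->
  forall x, D x = 0.
Proof.
move=> he De.
have Df (f : 'I_n -> 'I_n) : D [tuple tnth e (f i) | i < n] = 0.
  case: (boolP (injectiveb f)) => [/injectiveP finj | /injectivePn[i [j hij hf]]].
    rewrite -[RHS](alt_perm0 (perm finj) De); congr D.
    by apply: eq_from_tnth => i; rewrite !tnth_mktuple permE.
  by apply: (altD.2 _ i j hij); rewrite !tnth_mktuple hf.
suff main k x : (forall i : 'I_n, (k <= i)%N -> exists j, tnth x i = tnth e j) -> D x = 0.
  by move=> x; apply: (main n) => i; rewrite leqNgt ltn_ord.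
elim: k x => [|k IH] x hx.
  have [f hf] : {f : 'I_n -> 'I_n & forall i, tnth x i = tnth e (f i)}.
    by apply: (@boolp.choice _ _ (fun i j => tnth x i = tnth e j)) => i; apply: hx.
  rewrite -(Df f); congr D; apply: eq_from_tnth => i.
  by rewrite tnth_mktuple hf.
case: (ltnP k n) => hk; last first.
  by apply: IH => i hi; move: (leq_trans (leq_ltn_trans hi (ltn_ord i)) hk); rewrite ltnn.
pose i := Ordinal hk; have [c hc] := he (tnth x i).
rewrite -(tset_id x i) hc /zlincomb alt_sum big1 // => j _.
rewrite altMz IH ?mul0rz // => l hl; rewrite tnth_tset.
case: eqP => [_|/eqP hli]; first by exists j.
apply: hx; rewrite ltn_neqAle hl andbT; apply: contraNneq hli => hkl.
by apply/eqP/val_inj.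
Qed.

End Alternating.

Definition ext_lift (D : n.-tuple M -> int) (u : extpow n M) : int :=
  fglift (D : _ -> int^o) (repr u).

Lemma ext_liftE (D : n.-tuple M -> int) : alternating_map D ->
  forall v, ext_lift D (\pi_(extpow n M) v) = fglift (D : _ -> int^o) v.
Proof.
move=> altD v.
have fgenE x : fglift (D : _ -> int^o) (fgen x) = D x.
  by rewrite /fgen liftU scale1r.
have fB := @lift_is_additive int _ int^o D.
have h u : ext_relation u -> fglift (D : _ -> int^o) u = 0.
  elim=> [|{}u w _ hu _ hw|x i a b|x i j hij hx].
  - by rewrite -(subrr 0) fB subrr.
  - by rewrite fB hu hw subr0.
  - by rewrite !fB !fgenE altD.1 addrAC addrK subrr.
  - by rewrite fgenE; apply: altD.2 hx.
rewrite /ext_lift; apply/eqP; rewrite -subr_eq0 -fB; apply/eqP/h/asboolP.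
have := reprK (\pi_(extpow n M) v); move/eqP.
by rewrite -(Quotient.idealrBE (@ext_kernel n M)).
Qed.

Lemma ext_lift_wedge (D : n.-tuple M -> int) : alternating_map D ->
  forall x, ext_lift D (wedge x) = D x.
Proof. by move=> altD x; rewrite ext_liftE // /fgen liftU scale1r. Qed.

Lemma ext_liftB (D : n.-tuple M -> int) : alternating_map D ->
  {morph ext_lift D : u v / u - v}.
Proof.
move=> altD u v; rewrite -(reprK u) -(reprK v) -ext_piB !ext_liftE //.
exact: (@lift_is_additive int _ int^o D).
Qed.

(* The volume form det o co, as a map on the top exterior power. *)
Definition ext_vol (co : M -> 'rV[int]_n) : extpow n M -> int :=
  ext_lift (fun x => \det (\matrix_(i < n) co (tnth x i))).

Section Volume.
Variable co : {additive M -> 'rV[int]_n}.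

Lemma det_alternating :
  alternating_map (fun x => \det (\matrix_(i < n) co (tnth x i))).
Proof.
split=> [x i a b | x i j hij hx].
  rewrite -[X in _ = X + _]mul1r -[X in _ = _ + X]mul1r.
  apply: (determinant_multilinear (i0 := i)).
  - rewrite !scale1r; apply/rowP => k.
    by rewrite !mxE !tnth_tset eqxx raddfD mxE.
  - by apply/matrixP => k l; rewrite !mxE !tnth_tset eq_sym (negPf (neq_lift _ _)).
  - by apply/matrixP => k l; rewrite !mxE !tnth_tset eq_sym (negPf (neq_lift _ _)).
by apply: (determinant_alternate hij) => k; rewrite !mxE hx.
Qed.

Lemma ext_vol_wedge x : ext_vol co (wedge x) = \det (\matrix_(i < n) co (tnth x i)).
Proof. exact: (ext_lift_wedge det_alternating). Qed.

Lemma ext_volB : {morph ext_vol co : u v / u - v}.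
Proof. exact: (ext_liftB det_alternating). Qed.

HB.instance Definition _ := GRing.isZmodMorphism.Build _ _ (ext_vol co) ext_volB.

Variable e : n.-tuple M.
Hypothesis coK : forall a, zlincomb e (co a) = a.
Hypothesis co_e : forall i j, co (tnth e i) 0 j = (i == j)%:R.

Lemma ext_vol_basis : ext_vol co (wedge e) = 1.
Proof.
rewrite ext_vol_wedge (_ : \matrix_i _ = 1%:M) ?det1 //.
by apply/matrixP => i j; rewrite !mxE co_e.
Qed.

Lemma ext_volK u : wedge e *~ ext_vol co u = u.
Proof.
elim/ext_ind: u => [|u v hu hv|x]; first by rewrite raddf0.
  by rewrite raddfB mulrzBr hu hv.
apply/eqP; rewrite eq_sym -subr_eq0; apply/eqP.
pose D y := wedge y - wedge e *~ ext_vol co (wedge y).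
have [wD wA] := wedge_alternating.
have altD : alternating_map D.
  split=> [y i a b | y i j hij hy]; rewrite /D.
    by rewrite wD raddfD mulrzDr opprD !addrA; congr (_ + _); rewrite -!addrA; congr (_ + _); rewrite addrC.
  by rewrite (wA _ _ _ hij hy) raddf0 mulr0z subrr.
apply: (alt_basis0 altD (e := e)) => [a|]; first by exists (co a).
by rewrite /D ext_vol_basis mulr1z subrr.
Qed.

End Volume.
End ExteriorTheory.

Lemma modZ_eq (R : comNzRingType) (x y : R) (n : int) :
  x = y + n%:~R -> \pi_(modZ R) x = \pi_(modZ R) y.
Proof.
move=> ->; apply/eqP; rewrite -(Quotient.idealrBE (@Zone R)) addrC addKr.
by apply/asboolP; exists n.
Qed.

Lemma modZ_repr (R : comNzRingType) (x : R) :
  exists n : int, repr (\pi_(modZ R) x) = x + n%:~R.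
Proof.
have := reprK (\pi_(modZ R) x); move/eqP.
rewrite -(Quotient.idealrBE (@Zone R)) => /asboolP[n hn].
by exists n; rewrite -hn addrC subrK.
Qed.

Lemma modZ_piB (R : comNzRingType) (x y : R) :
  \pi_(modZ R) (x - y) = \pi_(modZ R) x - \pi_(modZ R) y.
Proof. by rewrite (Quotient.pi_add (@Zone R)) (Quotient.pi_opp (@Zone R)). Qed.

HB.instance Definition _ (R : comNzRingType) :=
  GRing.isZmodMorphism.Build _ _ (\pi_(modZ R)) (@modZ_piB R).

Lemma det_mx22 (K : comNzRingType) (A : 'M[K]_2) :
  \det A = A 0 0 * A 1 1 - A 0 1 * A 1 0.
Proof.
rewrite (expand_det_row _ 0) !big_ord_recl big_ord0 /cofactor !det_mx11 !mxE.
have -> : fintype.lift (0 : 'I_2) (0 : 'I_1) = 1 by apply: val_inj.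
have -> : fintype.lift 1 0 = 0 :> 'I_2 by apply: val_inj.
have -> : ord0 = 0 :> 'I_2 by [].
by rewrite /= /bump /= !expr0 expr1; ring.
Qed.

Lemma det_mx33 (K : comNzRingType) (A : 'M[K]_3) :
  \det A = A 0 0 * (A 1 1 * A 2 2 - A 1 2 * A 2 1)
         - A 0 1 * (A 1 0 * A 2 2 - A 1 2 * A 2 0)
         + A 0 2 * (A 1 0 * A 2 1 - A 1 1 * A 2 0).
Proof.
rewrite (expand_det_row _ 0) !big_ord_recl big_ord0 /cofactor !det_mx22 !mxE.
have l0 (i : 'I_2) : fintype.lift (0 : 'I_3) i = (if i == 0 then 1 else 2).
  by apply: val_inj; case: i => [[|[|[]]]].
have l1 (i : 'I_2) : fintype.lift (1 : 'I_3) i = (if i == 0 then 0 else 2).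
  by apply: val_inj; case: i => [[|[|[]]]].
have l2 (i : 'I_2) : fintype.lift (2 : 'I_3) i = (if i == 0 then 0 else 1).
  by apply: val_inj; case: i => [[|[|[]]]].
have -> : fintype.lift ord0 (ord0 : 'I_2) = 1 by apply: val_inj.
have -> : fintype.lift ord0 (fintype.lift ord0 (ord0 : 'I_1)) = 2 :> 'I_3 by apply: val_inj.
have -> : ord0 = 0 :> 'I_3 by [].
by rewrite !(l0, l1, l2) /= /bump /= !expr0 !expr1 expr2; ring.
Qed.

(* 4 Det(A0 x - B_f y), see four_det_of below. *)
Definition resolvent_bcf (f : bqf) : bcf :=
  BCF (- 1) (f2 f) (4 * f0 f * f4 f - f1 f * f3 f)
      (f1 f ^+ 2 * f4 f + f0 f * f3 f ^+ 2 - 4 * f0 f * f2 f * f4 f).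

Definition form_A0 : tqf := TQF 0 0 1 (- 1) 0 0.
Definition form_B (f : bqf) : tqf := TQF (f4 f) (f0 f) (f2 f) 0 (f3 f) (f1 f).

Lemma four_det_of (f : bqf) :
  four_det form_A0 (form_B f) = bcf_eval (resolvent_bcf f) 'X ('X)%:P.
Proof.
have halfE (n : int) : (n%:~R / 2 : rat)%:P%:P = n%:~R * (2^-1 : rat)%:P%:P :> {poly {poly rat}}.
  by rewrite polyCM polyCM !rmorph_int.
have intE (n : int) : (n%:~R : rat)%:P%:P = n%:~R :> {poly {poly rat}}.
  by rewrite !rmorph_int.
set H := (2^-1 : rat)%:P%:P in halfE.
have mE (q : tqf) : map_mx (fun r : rat => r%:P%:P) (tqf_mx q) =
    mx3 0 [:: [:: (q11 q)%:~R; (q12 q)%:~R * H; (q13 q)%:~R * H];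
              [:: (q12 q)%:~R * H; (q22 q)%:~R; (q23 q)%:~R * H];
              [:: (q13 q)%:~R * H; (q23 q)%:~R * H; (q33 q)%:~R]].
  by apply/matrixP => [[[|[|[|i]]] //= hi] [[|[|[|j]]] //= hj]];
    rewrite !mxE /=; [exact: intE | exact: halfE | exact: halfE
                     | exact: halfE | exact: intE | exact: halfE
                     | exact: halfE | exact: halfE | exact: intE].
rewrite /four_det !mE det_mx33 !mxE /bcf_eval /=.
have H2 : 2 * H = 1.
  have -> : 2 = (2 : rat)%:P%:P :> {poly {poly rat}} by rewrite !rmorph_nat.
  by rewrite /H -polyCM -polyCM divff.
set x : {poly {poly rat}} := 'X; set y : {poly {poly rat}} := ('X)%:P.
transitivity (- (2 * H) ^+ 2 * x ^+ 3 + (2 * H) ^+ 2 * (f2 f)%:~R * x ^+ 2 * y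
  + (4 * (f0 f)%:~R * (f4 f)%:~R - (2 * H) ^+ 3 * (f1 f)%:~R * (f3 f)%:~R) * x * y ^+ 2
  + ((2 * H) ^+ 2 * (f1 f)%:~R ^+ 2 * (f4 f)%:~R + (2 * H) ^+ 2 * (f0 f)%:~R * (f3 f)%:~R ^+ 2
     - 4 * (f0 f)%:~R * (f2 f)%:~R * (f4 f)%:~R) * y ^+ 3); first by ring.
by rewrite H2; ring.
Qed.



Section PairOf.
Variable f : bqf.
Local Notation R := (quartic_ring f).
Local Notation C := (cubic_ring (resolvent_bcf f)).

Definition qr_alpha : 3.-tuple (modZ R) :=
  [tuple \pi_(modZ R) (zeta3' f); \pi_(modZ R) (zeta1 f); \pi_(modZ R) (zeta2 f)].

(* Coordinates on R / Z in the basis alpha. *)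
Definition qr_t (x : modZ R) : 'rV[int]_3 :=
  let: (_, r1, r2, r3) := repr x in \row_(i < 3) [:: r3; r1; r2]`_i.

Definition qr_phi (x : modZ R) : modZ C :=
  cr_omega _ *~ tqf_eval (form_B f) (qr_t x) + cr_theta _ *~ tqf_eval form_A0 (qr_t x).

(* Coordinates on R in the basis 1, zeta3', zeta1, zeta2. *)
Definition qr_co (r : R) : 'rV[int]_4 :=
  let: (r0, r1, r2, r3) := r in \row_(i < 4) [:: r0; r3; r1; r2]`_i.

Definition cr_co (r : C) : 'rV[int]_3 :=
  let: (r0, r1, r2) := r in \row_(i < 3) [:: r0; r1; r2]`_i.

Definition qr_delta (u : extpow 4 R) : extpow 3 C :=
  wedge1 [tuple cr_omega (resolvent_bcf f); cr_theta (resolvent_bcf f)]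
    *~ ext_vol qr_co u.

Lemma qr_intr (n : int) : n%:~R = (n, 0, 0, 0) :> R.
Proof. by rewrite qr_mulz; congr (_, _, _, _) => /=; ring. Qed.

Lemma cr_intr (n : int) : n%:~R = (n, 0, 0) :> C.
Proof. by rewrite cr_mulz; congr (_, _, _) => /=; ring. Qed.

Lemma qr_t_pi (r : R) :
  qr_t (\pi_(modZ R) r) = \row_(i < 3) [:: r.2; r.1.1.2; r.1.2]`_i.
Proof.
case: (modZ_repr r) => n; rewrite /qr_t => ->; rewrite qr_intr.
by case: r => [[[r0 r1] r2] r3] /=; rewrite !addr0.
Qed.

Lemma qr_tB : {morph qr_t : x y / x - y}.
Proof.
move=> x y; rewrite -(reprK x) -(reprK y) -modZ_piB !qr_t_pi.
by apply/rowP => [[[|[|[|i]]] //= hi]]; rewrite !mxE.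
Qed.

HB.instance Definition _ := GRing.isZmodMorphism.Build _ _ qr_t qr_tB.

Lemma qr_coB : {morph qr_co : x y / x - y}.
Proof.
move=> [[[r0 r1] r2] r3] [[[s0 s1] s2] s3].
by apply/rowP => [[[|[|[|[|i]]]] //= hi]]; rewrite !mxE.
Qed.

HB.instance Definition _ := GRing.isZmodMorphism.Build _ _ qr_co qr_coB.

Lemma cr_coB : {morph cr_co : x y / x - y}.
Proof.
move=> [[r0 r1] r2] [[s0 s1] s2].
by apply/rowP => [[[|[|[|i]]] //= hi]]; rewrite !mxE.
Qed.

HB.instance Definition _ := GRing.isZmodMorphism.Build _ _ cr_co cr_coB.

Lemma qr_nic : nic_ring 4 R.
Proof.
exists qr_co.
exists (fun v : 'rV[int]_4 => (v 0 0, v 0 2, v 0 3, v 0 1)) => [[[[r0 r1] r2] r3] | v].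
  by rewrite /= !mxE.
by apply/rowP => [[[|[|[|[|i]]]] //= hi]]; rewrite !mxE /=; congr (v _ _); apply: val_inj.
Qed.

Lemma cr_nic : nic_ring 3 C.
Proof.
exists cr_co.
exists (fun v : 'rV[int]_3 => (v 0 0, v 0 1, v 0 2)) => [[[r0 r1] r2] | v].
  by rewrite /= !mxE.
by apply/rowP => [[[|[|[|i]]] //= hi]]; rewrite !mxE /=; congr (v _ _); apply: val_inj.
Qed.

Lemma qr_phi_quadratic : quadratic_map qr_phi.
Proof.
have bE (u v : modZ C) (p p' p'' q q' q'' : int) :
    u *~ p + v *~ q - (u *~ p' + v *~ q') - (u *~ p'' + v *~ q'')
    = u *~ (p - p' - p'') + v *~ (q - q' - q'').
  by rewrite !mulrzBr !opprD !addrA (ACl (1*3*5*2*4*6)%AC).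
have bD (u v : modZ C) (p p' q q' : int) :
    u *~ p + v *~ q + (u *~ p' + v *~ q') = u *~ (p + p') + v *~ (q + q').
  by rewrite !mulrzDr addrACA.
have tD x y : qr_t (x + y) = qr_t x + qr_t y by exact: raddfD.
have cE (u v : modZ C) (p p' q q' : int) :
    p = p' -> q = q' -> u *~ p + v *~ q = u *~ p' + v *~ q' by move=> -> ->.
split=> [a x|x x' y|x y y']; rewrite /qr_phi.
- rewrite raddfMz mulrzDl -!mulrzA /=.
  by apply: cE; rewrite /tqf_eval -!scaler_int !mxE intz; ring.
- rewrite !bE bD.
  by apply: cE; rewrite !tD /tqf_eval !mxE; ring.
- rewrite !bE bD.
  by apply: cE; rewrite !tD /tqf_eval !mxE; ring.
Qed.

Lemma qr_alphaE (t : 'rV[int]_3) :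
  zlincomb qr_alpha t = \pi_(modZ R) (0, t 0 1, t 0 2, t 0 0).
Proof.
rewrite /zlincomb !big_ord_recl big_ord0 addr0 !(tnth_nth 0) /= -!raddfMz -!raddfD /=.
congr (\pi_(modZ R) _); rewrite !qr_mulz.
have -> : fintype.lift ord0 ord0 = 1 :> 'I_3 by apply: val_inj.
have -> : fintype.lift ord0 (fintype.lift ord0 ord0) = 2 :> 'I_3 by apply: val_inj.
have -> : ord0 = 0 :> 'I_3 by [].
by congr (_, _, _, _) => /=; ring.
Qed.

Lemma qr_tK : cancel (zlincomb qr_alpha) qr_t.
Proof.
move=> t; rewrite qr_alphaE qr_t_pi /=.
by apply/rowP => [[[|[|[|i]]] //= hi]]; rewrite !mxE /=; congr (t _ _); apply: val_inj.
Qed.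

Lemma qr_alpha_zbasis : zbasis qr_alpha.
Proof.
exists qr_t => [|x]; first exact: qr_tK.
rewrite qr_alphaE -(reprK x) qr_t_pi !mxE /=; case: (repr x) => [[[r0 r1] r2] r3] /=.
by apply: (modZ_eq (n := - r0)); rewrite qr_intr; congr (_, _, _, _) => /=; ring.
Qed.

Definition cr_t (x : modZ C) : 'rV[int]_2 :=
  let: (_, r1, r2) := repr x in \row_(i < 2) [:: r1; r2]`_i.

Lemma cr_t_pi (r : C) : cr_t (\pi_(modZ C) r) = \row_(i < 2) [:: r.1.2; r.2]`_i.
Proof.
case: (modZ_repr r) => n; rewrite /cr_t => ->; rewrite cr_intr.
by case: r => [[r0 r1] r2] /=; rewrite !addr0.
Qed.

Lemma cr_tE (b a : int) :
  cr_omega _ *~ b + cr_theta _ *~ a = \pi_(modZ C) (0, b, a).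
Proof.
rewrite -!raddfMz -!raddfD /=; congr (\pi_(modZ C) _).
by rewrite !cr_mulz; congr (_, _, _) => /=; ring.
Qed.

Lemma cr_zbasis : zbasis [tuple cr_omega (resolvent_bcf f); cr_theta (resolvent_bcf f)].
Proof.
have lc (t : 'rV[int]_2) :
    zlincomb [tuple cr_omega (resolvent_bcf f); cr_theta _] t = \pi_(modZ C) (0, t 0 0, t 0 1).
  rewrite /zlincomb !big_ord_recl big_ord0 addr0 !(tnth_nth 0) /= cr_tE.
  have -> : fintype.lift ord0 ord0 = 1 :> 'I_2 by apply: val_inj.
  by [].
exists cr_t => [t|x]; rewrite lc.
  rewrite cr_t_pi /=.
  by apply/rowP => [[[|[|i]] //= hi]]; rewrite !mxE /=; congr (t _ _); apply: val_inj.
rewrite -(reprK x) cr_t_pi !mxE /=; case: (repr x) => [[r0 r1] r2] /=.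
by apply: (modZ_eq (n := - r0)); rewrite cr_intr; congr (_, _, _) => /=; ring.
Qed.

Definition qr_e : 4.-tuple R := [tuple 1; zeta3' f; zeta1 f; zeta2 f].
Definition cr_e : 3.-tuple C := [tuple (1, 0, 0); (0, 1, 0); (0, 0, 1)].

Lemma qr_coK a : zlincomb qr_e (qr_co a) = a.
Proof.
rewrite /zlincomb !big_ord_recl big_ord0 addr0 !(tnth_nth 0) /= !qr_mulz.
case: a => [[[a0 a1] a2] a3]; rewrite !mxE /=.
by congr (_, _, _, _) => /=; ring.
Qed.

Lemma qr_co_e i j : qr_co (tnth qr_e i) 0 j = (i == j)%:R.
Proof.
by case: i => [[|[|[|[|i]]]] //= hi]; case: j => [[|[|[|[|j]]]] //= hj];
   rewrite mxE.
Qed.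

Lemma cr_coK a : zlincomb cr_e (cr_co a) = a.
Proof.
rewrite /zlincomb !big_ord_recl big_ord0 addr0 !(tnth_nth 0) /= !cr_mulz.
case: a => [[a0 a1] a2]; rewrite !mxE /=.
by congr (_, _, _) => /=; ring.
Qed.

Lemma cr_co_e i j : cr_co (tnth cr_e i) 0 j = (i == j)%:R.
Proof.
by case: i => [[|[|[|i]]] //= hi]; case: j => [[|[|[|j]]] //= hj];
   rewrite mxE.
Qed.

Lemma cr_vol_wedge1 (x y : modZ C) :
  ext_vol cr_co (wedge1 [tuple x; y])
  = cr_t x 0 0 * cr_t y 0 1 - cr_t x 0 1 * cr_t y 0 0.
Proof.
rewrite ext_vol_wedge det_mx33 !mxE !(tnth_nth 0) /= /cr_t.
case: (repr x) => [[x0 x1] x2]; case: (repr y) => [[y0 y1] y2].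
by rewrite !mxE /=; ring.
Qed.

Lemma qr_deltaB : {morph qr_delta : u v / u - v}.
Proof. by move=> u v; rewrite /qr_delta raddfB /= mulrzBr. Qed.

HB.instance Definition _ := GRing.isZmodMorphism.Build _ _ qr_delta qr_deltaB.

Lemma cr_volK u :
  wedge1 [tuple cr_omega (resolvent_bcf f); cr_theta (resolvent_bcf f)]
    *~ ext_vol cr_co u = u.
Proof.
rewrite -[in RHS](ext_volK cr_coK cr_co_e u); congr (_ *~ _).
rewrite -[LHS](ext_volK cr_coK cr_co_e) cr_vol_wedge1 !cr_t_pi !mxE /=.
by rewrite mulr1 mulr0 subr0.
Qed.

Lemma qr_delta_iso : bijective qr_delta.
Proof.
exists (fun v => wedge qr_e *~ ext_vol cr_co v) => [u|v]; rewrite /qr_delta.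
  rewrite raddfMz /= cr_vol_wedge1 !cr_t_pi !mxE /= mulr1 mulr0 subr0 intz.
  exact: (ext_volK qr_coK qr_co_e).
by rewrite raddfMz /= (ext_vol_basis qr_co_e) intz cr_volK.
Qed.

Lemma qr_vol (a b c : R) :
  ext_vol qr_co (wedge [tuple 1; a; b; c])
  = \det (mx3 0 [:: [:: a.2; a.1.1.2; a.1.2]; [:: b.2; b.1.1.2; b.1.2];
                    [:: c.2; c.1.1.2; c.1.2]]).
Proof.
rewrite ext_vol_wedge (expand_det_row _ 0) big_ord_recl big1 => [|j _]; last first.
  rewrite !mxE.
  by case: j => [[|[|[|j]]] //= hj]; rewrite mul0r.
rewrite !mxE /= mul1r addr0 /cofactor expr0 mul1r.
congr (\det _); apply/matrixP => i j; rewrite !mxE (tnth_nth (0 : R)).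
case: a => [[[a0 a1] a2] a3]; case: b => [[[b0 b1] b2] b3]; case: c => [[[c0 c1] c2] c3].
by case: i => [[|[|[|i]]] //= hi]; case: j => [[|[|[|j]]] //= hj]; rewrite mxE.
Qed.

Lemma qr_delta_phi (x y : R) :
  qr_delta (wedge [tuple 1; x; y; x * y])
  = wedge1 [tuple qr_phi (\pi_(modZ R) x); qr_phi (\pi_(modZ R) y)].
Proof.
rewrite -[RHS]cr_volK; congr (_ *~ _).
rewrite cr_vol_wedge1 /qr_phi !cr_tE !cr_t_pi !mxE /= !qr_t_pi /tqf_eval !mxE /=.
rewrite qr_vol det_mx33 !mxE /=.
case: x => [[[x0 x1] x2] x3]; case: y => [[[y0 y1] y2] y3] /=.
by ring.
Qed.

Lemma qr_delta_alpha :
  qr_delta (wedge1 qr_alpha)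
  = wedge1 [tuple cr_omega (resolvent_bcf f); cr_theta (resolvent_bcf f)].
Proof.
rewrite -[RHS]mulr1z; congr (_ *~ _).
have -> : wedge1 qr_alpha = wedge [tuple 1; repr (tnth qr_alpha 0);
    repr (tnth qr_alpha 1); repr (tnth qr_alpha 2)].
  by congr wedge; apply: val_inj; rewrite /= !(tnth_nth 0).
rewrite !(tnth_nth 0) /= qr_vol det_mx33 !mxE /=.
have [n1 ->] := modZ_repr (zeta3' f); have [n2 ->] := modZ_repr (zeta1 f).
have [n3 ->] := modZ_repr (zeta2 f); rewrite !qr_intr /=.
by ring.
Qed.

Lemma qr_resolvent_form : resolvent_form_condition qr_phi qr_delta.
Proof.
exists qr_alpha, (cr_omega _), (cr_theta _), form_A0, (form_B f), (resolvent_bcf f).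
split; first by split; [exact: qr_alpha_zbasis | exact: cr_zbasis].
split; [exact: qr_delta_alpha | | exact: four_det_of | exact: cubic_ring_form].
by move=> t; rewrite /qr_phi qr_tK.
Qed.

Lemma cr_monogenized : monogenized_by (cr_omega (resolvent_bcf f)).
Proof.
rewrite /monogenized_by.
have [n hn] : exists n : int, repr (cr_omega (resolvent_bcf f)) = ((0, 1, 0) : C) + n%:~R.
  exact: (modZ_repr ((0, 1, 0) : C)).
rewrite hn.
move=> [[c0 c1] c2]; pose q : {poly int} := 'X + (- n)%:P.
pose b := - cb (resolvent_bcf f); pose c := - cc (resolvent_bcf f).
exists (c0%:P + c1%:P * q + c2%:P * (q * q + b%:P * q + c%:P)).
set w : C := (0, 1, 0) + _; pose ev (p : {poly int}) : C := (map_poly intr p).[w].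
have eD p r : ev (p + r) = ev p + ev r by rewrite /ev rmorphD hornerD.
have eM p r : ev (p * r) = ev p * ev r by rewrite /ev rmorphM hornerM.
have eC k : ev k%:P = k%:~R by rewrite /ev map_polyC hornerC.
have eX : ev 'X = w by rewrite /ev map_polyX hornerX.
rewrite -/(ev _) /q !(eD, eM, eC, eX) /w.
by rewrite !cr_intr; congr (_, _, _) => /=; rewrite /b /c /=; ring.
Qed.

Definition form_resolvent : cubic_resolvent R :=
  CubicResolvent cr_nic qr_phi_quadratic qr_delta_iso qr_delta_phi qr_resolvent_form.

Definition pair_of_form : monogenized_pair :=
  @MonogenizedPair R qr_nic form_resolvent (cr_omega (resolvent_bcf f)) cr_monogenized.

End PairOf.

Definition classes (T : Type) (r : T -> T -> Prop) : Type :=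
  {S : T -> Prop | exists x, S = r x}.

Definition cls (T : Type) (r : T -> T -> Prop) (x : T) : classes r :=
  exist _ (r x) (ex_intro _ x erefl).

(* Main.v *)
From HB Require Import structures.
Require Import Defs.
From mathcomp Require Import all_boot all_order all_algebra.
From mathcomp Require Import generic_quotient boolp classical_sets.
From mathcomp Require Import ring zify.

Set Implicit Arguments.
Unset Strict Implicit.
Unset Printing Implicit Defensive.

Import Order.TTheory GRing.Theory Num.Theory.
Local Open Scope ring_scope.
Local Open Scope quotient_scope.

(** Why the theorem is true.

    A monogenized resolvent (Q, C) is encoded by a pair (A, B) of integral
    ternary quadratic forms once bases of Q/Z and C/Z are chosen, with the
    generator of C as the first basis vector omega of C/Z.  This choice is
    possible because a generator modulo Z is a primitive vector
    ([monogenic_primitive]); and since Z[omega] has index |a| in C, where a is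
    the x^3-coefficient of the cubic form 4 Det(A x - B y), the number
    4 Det(A) = a is a unit ([monogenic_leading]), which a change of orientation
    makes equal to -1.  Indefinite reduction shows that A is then properly
    equivalent to A0 = t3^2 - t1 t2 ([tqf_unimodular]).  The remaining freedom
    of adding a multiple of omega to theta changes B by a multiple of A0 and
    serves to kill the coefficient q12 of B, which leaves B = B_f for a binary
    quartic form f ([adapted_normal_form]).

    Conversely (A0, B_f) determines everything.  The cubic ring is given by its
    form.  The resolvent identity compares the volume of (1, x, y, xy) in Q with
    B(x) A(y) - A(x) B(y); this bidegree (2, 2) identity fixes the
    multiplication table of Q modulo constants once the lifts of the basis are
    normalized ([structure_constants]), and associativity fixes the constants
    ([table_constants]).  The result is the table of R_f, so (Q, C) is
    isomorphic to the pair of f ([adapted_iso]); this is surjectivity.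

    For injectivity and well-definedness, note that A0 vanishes on the conic
    (y^2, x^2, x y) and that B_f restricts there to f(x, y).  An isomorphism of
    pairs gives a matrix M with A0(tM) = A0(t) and B_g(tM) = B_f(t) + u A0(t).
    Integral isometries of A0 are, up to sign, the symmetric squares of elements
    of GL_2(Z) ([form_A0_isometry]), so restricting the second equation to the
    conic exhibits f as a substitution of g ([mp_iso_gl2_equiv]).  Conversely a
    substitution acts on Q/Z through its symmetric square
    ([gl2_equiv_mp_iso]).

    Discriminants do not depend on bases and are preserved by isomorphisms
    ([basis_disc_morph]); for R_f and C_f they are computed from the explicit
    trace forms. *)

(** * Integral ternary quadratic forms *)

Definition row3 (x y z : int) : 'rV[int]_3 := \row_(i < 3) [:: x; y; z]`_i.

Lemma row3E x y z : (row3 x y z 0 0 = x) * (row3 x y z 0 1 = y) * (row3 x y z 0 2 = z).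
Proof. by rewrite !mxE. Qed.

Lemma row3_eta (t : 'rV[int]_3) : t = row3 (t 0 0) (t 0 1) (t 0 2).
Proof.
by apply/rowP => [[[|[|[|i]]] //= hi]]; rewrite mxE /=; congr (t _ _); apply: val_inj.
Qed.

Lemma big_ord3 (V : zmodType) (F : 'I_3 -> V) : \sum_i F i = F 0 + F 1 + F 2.
Proof.
rewrite !big_ord_recl big_ord0 addr0 addrA.
by congr (F _ + F _ + F _); apply: val_inj.
Qed.

Lemma mx3E (K : Type) (x0 : K) a b c d e f g h i
    (M := mx3 x0 [:: [:: a; b; c]; [:: d; e; f]; [:: g; h; i]]) :
  ((M 0 0 = a) * (M 0 1 = b) * (M 0 2 = c)) * ((M 1 0 = d) * (M 1 1 = e) * (M 1 2 = f))
  * ((M 2 0 = g) * (M 2 1 = h) * (M 2 2 = i)).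
Proof. by rewrite /M !mxE. Qed.

Lemma mulmx_row3 (t : 'rV[int]_3) (M : 'M[int]_3) :
  t *m M = row3 (t 0 0 * M 0 0 + t 0 1 * M 1 0 + t 0 2 * M 2 0)
                (t 0 0 * M 0 1 + t 0 1 * M 1 1 + t 0 2 * M 2 1)
                (t 0 0 * M 0 2 + t 0 1 * M 1 2 + t 0 2 * M 2 2).
Proof. by rewrite [LHS]row3_eta; congr row3; rewrite mxE big_ord3. Qed.

(** Twice the symmetric matrix of [q], which is integral. *)
Definition tqf_gram (q : tqf) : 'M[int]_3 :=
  mx3 0 [:: [:: 2 * q11 q; q12 q; q13 q]; [:: q12 q; 2 * q22 q; q23 q];
            [:: q13 q; q23 q; 2 * q33 q]].

Lemma tqf_polarE (q : tqf) (s t : 'rV[int]_3) :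
  (s *m tqf_gram q *m t^T) 0 0 = tqf_eval q (s + t) - tqf_eval q s - tqf_eval q t.
Proof. by rewrite mxE big_ord3 mulmx_row3 !row3E !mx3E /tqf_eval !mxE; ring. Qed.

Lemma tqf_polar_inj (G G' : 'M[int]_3) :
  (forall s t : 'rV[int]_3, (s *m G *m t^T) 0 0 = (s *m G' *m t^T) 0 0) -> G = G'.
Proof.
move=> h; apply/matrixP => i j.
have E (H : 'M[int]_3) : H i j = ((delta_mx 0 i : 'rV_3) *m H *m (delta_mx 0 j : 'rV_3)^T) 0 0.
  by rewrite -rowE trmx_delta -colE !mxE.
by rewrite !E h.
Qed.

Lemma tqf_gram_pull (q q' : tqf) (M : 'M[int]_3) :
  (forall t, tqf_eval q' t = tqf_eval q (t *m M)) ->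
  tqf_gram q' = M *m tqf_gram q *m M^T.
Proof.
move=> h; apply: tqf_polar_inj => s t.
by rewrite tqf_polarE !h mulmxDl -tqf_polarE trmx_mul !mulmxA.
Qed.

Definition tqf_pull (M : 'M[int]_3) (q : tqf) : tqf :=
  let e i := row i M in let b i j := tqf_eval q (e i + e j) - tqf_eval q (e i) - tqf_eval q (e j) in
  TQF (tqf_eval q (e 0)) (tqf_eval q (e 1)) (tqf_eval q (e 2)) (b 0 1) (b 0 2) (b 1 2).

Lemma tqf_pullE M q t : tqf_eval (tqf_pull M q) t = tqf_eval q (t *m M).
Proof. by rewrite mulmx_row3 /tqf_pull /tqf_eval !row3E /= !mxE; ring. Qed.

(** Four times the determinant of the symmetric matrix of [q]. *)
Definition tqf_det4 (q : tqf) : int :=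
  4 * q11 q * q22 q * q33 q + q12 q * q13 q * q23 q
  - q11 q * q23 q ^+ 2 - q22 q * q13 q ^+ 2 - q33 q * q12 q ^+ 2.

Lemma det_tqf_gram q : \det (tqf_gram q) = 2 * tqf_det4 q.
Proof. by rewrite det_mx33 !mx3E /tqf_det4; ring. Qed.

Definition tqf_equiv (q q' : tqf) : Prop :=
  exists2 M : 'M[int]_3, \det M = 1 & forall t, tqf_eval q' t = tqf_eval q (t *m M).

Lemma tqf_equiv_refl q : tqf_equiv q q.
Proof. by exists 1%:M => [|t]; rewrite ?det1 ?mulmx1. Qed.

Lemma tqf_equiv_trans q q' q'' : tqf_equiv q q' -> tqf_equiv q' q'' -> tqf_equiv q q''.
Proof.
move=> [M dM hM] [N dN hN]; exists (N *m M) => [|t]; first by rewrite det_mulmx dN dM mulr1.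
by rewrite hN hM mulmxA.
Qed.

Lemma tqf_equiv_det4 q q' : tqf_equiv q q' -> tqf_det4 q' = tqf_det4 q.
Proof.
move=> [M dM /tqf_gram_pull hG]; apply: (@mulfI int 2) => //.
by rewrite -!det_tqf_gram hG !det_mulmx det_tr dM mulr1 mul1r.
Qed.

Lemma tqf_equiv_mx q q' (a b c d e f g h i : int) :
  a * (e * i - f * h) - b * (d * i - f * g) + c * (d * h - e * g) = 1 ->
  (forall x y z, tqf_eval q' (row3 x y z) =
     tqf_eval q (row3 (x * a + y * d + z * g) (x * b + y * e + z * h) (x * c + y * f + z * i))) ->
  tqf_equiv q q'.
Proof.
move=> hd hq; exists (mx3 0 [:: [:: a; b; c]; [:: d; e; f]; [:: g; h; i]]).
  by rewrite det_mx33 !mx3E.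
by move=> t; rewrite [in LHS](row3_eta t) hq mulmx_row3 !mx3E.
Qed.

(** Effect of the basis change (e1, e2) -> (e2, - e1). *)
Lemma tqf_equiv_swap q :
  tqf_equiv q (TQF (q22 q) (q11 q) (q33 q) (- q12 q) (q23 q) (- q13 q)).
Proof.
apply: (@tqf_equiv_mx _ _ 0 1 0 (-1) 0 0 0 0 1) => [|x y z]; first by ring.
by rewrite /tqf_eval !row3E /=; ring.
Qed.

(** Effect of the basis change e2 -> p e2 + r e3, e3 -> s e2 + u e3. *)
Lemma tqf_equiv_block q p r s u : p * u - r * s = 1 ->
  tqf_equiv q (TQF (q11 q) (q22 q * p ^+ 2 + q33 q * r ^+ 2 + q23 q * p * r)
                   (q22 q * s ^+ 2 + q33 q * u ^+ 2 + q23 q * s * u)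
                   (q12 q * p + q13 q * r) (q12 q * s + q13 q * u)
                   (2 * q22 q * p * s + 2 * q33 q * r * u + q23 q * (p * u + r * s))).
Proof.
move=> h; apply: (@tqf_equiv_mx _ _ 1 0 0 0 p r 0 s u) => [|x y z]; first by lia.
by rewrite /tqf_eval !row3E /=; ring.
Qed.

(** Effect of the basis change e2 -> e2 + k e1, e3 -> e3 + l e1. *)
Lemma tqf_equiv_translate q k l :
  tqf_equiv q (TQF (q11 q) (q22 q + k * q12 q + k ^+ 2 * q11 q)
                   (q33 q + l * q13 q + l ^+ 2 * q11 q)
                   (q12 q + 2 * k * q11 q) (q13 q + 2 * l * q11 q)
                   (q23 q + k * q13 q + l * q12 q + 2 * k * l * q11 q)).
Proof.
apply: (@tqf_equiv_mx _ _ 1 0 0 k 1 0 l 0 1) => [|x y z]; first by ring.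
by rewrite /tqf_eval !row3E /=; ring.
Qed.

Definition tqf_disc12 (q : tqf) : int := 4 * q11 q * q22 q - q12 q ^+ 2.

Lemma centred_remainder (a b : int) : b != 0 -> exists k : int, 2 * `|a + k * b| <= `|b|.
Proof.
move=> b0; have e := divz_eq a b; have r0 := modz_ge0 a b0; have r1 := ltz_mod a b0.
case: (leP (2 * (a %% b)%Z) `|b|) => h.
  by exists (- (a %/ b)%Z); rewrite {1}e mulNr addrAC subrr add0r; lia.
exists (- (a %/ b)%Z - (if 0 < b then 1 else -1)).
have -> : a + (- (a %/ b)%Z - (if 0 < b then 1 else -1)) * b = (a %% b)%Z - `|b|.
  rewrite {1}e; case: ifP => b1; [rewrite gtr0_norm // | rewrite ler0_norm ?leNgt ?b1 //]; ring.
by lia.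
Qed.

Lemma least_nat (T : Type) (P : T -> Prop) (m : T -> nat) x : P x ->
  exists2 y, P y & forall z, P z -> (m y <= m z)%N.
Proof.
move=> Px; have ex : exists n, `[< exists2 y, P y & m y = n >].
  by exists (m x); apply/asboolP; exists x.
case: (ex_minnP ex) => n /asboolP[y Py hy] hmin; exists y => // z Pz.
by rewrite hy; apply: hmin; apply/asboolP; exists z.
Qed.

(** Here a, x, y, r are the absolute values of q11, of the upper left minors
    for the bases (e1, e2) and (e1, e3), and of the mixed minor.  The
    inequalities combine to 27 a^2 <= 3 x^2 <= 16 a. *)
Lemma hermite_bound (a x y r : int) :
  1 <= a -> 0 <= r -> 2 * r <= x -> x <= y -> 3 * a ^+ 2 <= x ->
  x * y <= 4 * a + r ^+ 2 -> False.
Proof.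
move=> a1 r0 rx xy ax h.
have : (2 * r) * (2 * r) <= x * x by apply: ler_pM; lia.
have : x * x <= x * y by rewrite ler_wpM2l //; lia.
have aa : a <= a * a by rewrite ler_peMl //; lia.
have : (3 * a) * (3 * a) <= x * x by apply: ler_pM; lia.
lia.
Qed.

(** Hermite reduction: minimize |q11| over the proper equivalence class, then
    the binary discriminant |4 q11 q22 - q12^2|.  If q11 were not zero,
    minimality against the two swaps of neighbouring basis vectors would give
    the bounds that [hermite_bound] refutes. *)
Lemma tqf_isotropic q : `|tqf_det4 q| = 1 ->
  exists2 q', tqf_equiv q q' & q11 q' = 0.
Proof.
move=> hD.
have [q1 e1 m1] := @least_nat _ (tqf_equiv q) (fun p => `|q11 p|%N) _ (tqf_equiv_refl q).
pose P p := tqf_equiv q p /\ `|q11 p|%N = `|q11 q1|%N.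
have [q2 [e2 a2] m2] := @least_nat _ P (fun p => `|tqf_disc12 p|%N) q1 (conj e1 erefl).
exists q2 => //; apply/eqP/negPn/negP => a0.
have [k hk] := @centred_remainder (q12 q2) (2 * q11 q2) ltac:(lia).
(* In q3, e2 has been shifted by a multiple of e1 to get |q12| <= |q11|. *)
have e23 := tqf_equiv_translate q2 k 0; set q3 := TQF _ _ _ _ _ _ in e23.
have d23 : tqf_disc12 q3 = tqf_disc12 q2 by rewrite /tqf_disc12 /=; ring.
have e3 := tqf_equiv_trans e2 e23.
have b3 : `|q12 q3| <= `|q11 q2| by rewrite /=; lia.
have c3 : `|q11 q2| <= `|q22 q3|.
  have h : (`|q11 q2| <= `|q22 q3|)%N.
    by rewrite a2; exact: (m1 _ (tqf_equiv_trans e3 (tqf_equiv_swap q3))).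
  by move: h; move: (q22 q3) => c; lia.
have d0 : 3 * (q11 q2) ^+ 2 <= `|tqf_disc12 q3|.
  rewrite /tqf_disc12 [q11 q3]/=; move: b3 c3; set b := q12 q3; set c := q22 q3; set a := q11 q2.
  move=> b3 c3; have : a * a <= `|a * c|.
    by rewrite normrM -expr2 -[a ^+ 2]ger0_norm ?sqr_ge0 // normrX expr2 ler_wpM2l.
  have : b * b <= a * a.
    rewrite -!expr2 -[b ^+ 2]ger0_norm ?sqr_ge0 // -[a ^+ 2]ger0_norm ?sqr_ge0 //.
    by rewrite !normrX !expr2 ler_pM.
  have : 0 <= b * b by rewrite -expr2 sqr_ge0.
  rewrite -mulrA expr2 [b ^+ 2]expr2; move: (a * c) (a * a) (b * b) => u v w; lia.
have x0 : tqf_disc12 q3 != 0.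
  rewrite -normr_gt0; apply: lt_le_trans d0.
  by rewrite pmulr_rgt0 // exprn_even_gt0.
have [l hl] := @centred_remainder (2 * q11 q3 * q23 q3 - q12 q3 * q13 q3) _ x0.
(* In q4, e3 has been shifted by a multiple of e2 to reduce the mixed minor;
   in q5, e2 and e3 are swapped. *)
have e34 := @tqf_equiv_block q3 1 0 l 1 ltac:(ring).
set q4 := TQF _ _ _ _ _ _ in e34.
have e4 := tqf_equiv_trans e3 e34.
have e45 := @tqf_equiv_block q4 0 1 (-1) 0 ltac:(ring).
set q5 := TQF _ _ _ _ _ _ in e45.
have e5 := tqf_equiv_trans e4 e45.
have d34 : tqf_disc12 q4 = tqf_disc12 q3 by rewrite /tqf_disc12 /=; ring.
have d45 : `|tqf_disc12 q4| <= `|tqf_disc12 q5|.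
  have h : (`|tqf_disc12 q4| <= `|tqf_disc12 q5|)%N by rewrite d34 d23; exact: (m2 q5 (conj e5 a2)).
  by move: h; move: (tqf_disc12 q4) (tqf_disc12 q5) => x y; lia.
have dd : tqf_disc12 q4 * tqf_disc12 q5 - (2 * q11 q4 * q23 q4 - q12 q4 * q13 q4) ^+ 2
    = 4 * q11 q4 * tqf_det4 q4.
  by rewrite /tqf_disc12 /tqf_det4 /q5 /=; ring.
have hr : 2 * `|2 * q11 q4 * q23 q4 - q12 q4 * q13 q4| <= `|tqf_disc12 q4|.
  rewrite d34; move: hl; congr (2 * `|_| <= _); rewrite /tqf_disc12 /=; ring.
have a4 : q11 q4 = q11 q2 by [].
have D4 : `|tqf_det4 q4| = 1 by rewrite (tqf_equiv_det4 e4).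
move: dd hr d45 d0; rewrite -d34 a4.
move: (tqf_disc12 q4) (tqf_disc12 q5) (2 * _ * _ - _) (tqf_det4 q4) D4 => x y r D D1 dd hr d45 d0.
apply: (@hermite_bound `|q11 q2| `|x| `|y| `|r|) => //.
- by rewrite -gtz0_ge1 normr_gt0.
- by rewrite -normrX ger0_norm ?sqr_ge0.
rewrite -normrM; have -> : x * y = 4 * q11 q2 * D + r ^+ 2 by rewrite -dd; ring.
by apply: le_trans (ler_normD _ _) _; rewrite normrX lerD2r !normrM D1 mulr1.
Qed.

(** After reduction e1 is isotropic and gcd (q12, q13) divides
    4 Det = -1, so e2, e3 can be chosen with q12 = -1, q13 = 0; then
    q33 = 1, and q22, q23 are cleared by adding multiples of e1. *)
Lemma tqf_unimodular q : tqf_det4 q = -1 -> tqf_equiv q form_A0.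
Proof.
move=> hD; have [|q1 e1 a1] := @tqf_isotropic q; first by rewrite hD.
have [u [v huv]] := Bezoutz (q12 q1) (q13 q1).
have hD1 : tqf_det4 q1 = -1 by rewrite (tqf_equiv_det4 e1).
have g1 : gcdz (q12 q1) (q13 q1) = 1.
  suff: (gcdz (q12 q1) (q13 q1) %| 1)%Z by rewrite dvdz1 => /eqP; rewrite /gcdz /= => ->.
  have /dvdzP[b hb] := dvdz_gcdl (q12 q1) (q13 q1).
  have /dvdzP[c hc] := dvdz_gcdr (q12 q1) (q13 q1).
  move: hb hc hD1; rewrite /tqf_det4 a1; move: (gcdz _ _) => g hb hc hD1; apply/dvdzP.
  exists (- (b * q13 q1 * q23 q1 - q22 q1 * q13 q1 * c - q33 q1 * q12 q1 * b)).
  rewrite -[LHS]opprK -[- 1]/(-1) -hD1 mulNr; congr (- _).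
  by rewrite hb hc; ring.
rewrite g1 in huv.
(* The new q12 is - (u q12 + v q13) = -1, and the new q13 vanishes. *)
have e12 := @tqf_equiv_block q1 (- u) (- v) (q13 q1) (- q12 q1) ltac:(lia).
set q2 := TQF _ _ _ _ _ _ in e12.
have b2 : q12 q2 = -1 by rewrite /=; lia.
have c2 : q13 q2 = 0 by rewrite /=; ring.
have a2 : q11 q2 = 0 by [].
have e2 := tqf_equiv_trans e1 e12.
have d2 : q33 q2 = 1.
  have := tqf_equiv_det4 e2; rewrite hD /tqf_det4 a2 b2 c2; lia.
apply: tqf_equiv_trans e2 _; clearbody q2.
have := tqf_equiv_translate q2 (q22 q2) (q23 q2).
rewrite a2 b2 c2 d2 /form_A0; congr (tqf_equiv _ (TQF _ _ _ _ _ _)); ring.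
Qed.

(** * Integral isometries of the form t3^2 - t1 t2 *)

Lemma form_A0E x y z : tqf_eval form_A0 (row3 x y z) = z ^+ 2 - x * y.
Proof. by rewrite /tqf_eval !row3E /=; ring. Qed.

(** The isotropic vector of t3^2 - t1 t2 attached to (x, y). *)
Definition conic (x y : int) : 'rV[int]_3 := row3 (y ^+ 2) (x ^+ 2) (x * y).

(** The square root of |u| is gcd (u, w), by two Bezout relations. *)
Lemma coprime_mul_sqr (u v w : int) :
  w ^+ 2 = u * v -> coprimez u v -> exists d : int, `|u| = d ^+ 2.
Proof.
move=> hw /coprimezP[[p q] /= hpq]; have [r [s hd]] := Bezoutz u w.
exists (gcdz u w); set d := gcdz u w in hd *.
have /dvdzP[u' hu] := dvdz_gcdl u w; have /dvdzP[w' hw'] := dvdz_gcdr u w.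
rewrite -/d in hu hw'.
have d1 : (u %| d ^+ 2)%Z.
  apply/dvdzP; exists (r ^+ 2 * u + 2 * r * s * w + s ^+ 2 * v).
  rewrite -hd; transitivity (r ^+ 2 * u ^+ 2 + 2 * r * s * w * u + s ^+ 2 * w ^+ 2).
    by ring.
  by rewrite hw; ring.
have d2 : (d ^+ 2 %| u)%Z.
  apply/dvdzP; exists (p * u' ^+ 2 + q * w' ^+ 2).
  transitivity (p * u ^+ 2 + q * w ^+ 2).
    by rewrite hw -[LHS]mulr1 -hpq; ring.
  by rewrite {1}hu {1}hw'; ring.
have : `|u|%N == `|d ^+ 2|%N by rewrite eqn_dvd -!dvdzE d1 d2.
by rewrite -eqz_nat !abszE [`|d ^+ 2|]ger0_norm ?sqr_ge0 // => /eqP.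
Qed.

Lemma conic_point (x y z : int) : z ^+ 2 = x * y -> coprimez x y ->
  exists s c d : int, s ^+ 2 = 1 /\ [/\ x = s * d ^+ 2, y = s * c ^+ 2 & z = s * (c * d)].
Proof.
move=> hz cxy.
have [d hd] := coprime_mul_sqr hz cxy.
have [c hc] : exists c : int, `|y| = c ^+ 2.
  by apply: (@coprime_mul_sqr y x z); rewrite 1?mulrC 1?coprimez_sym.
have [s [s1 hx hy]] : exists s : int, [/\ s ^+ 2 = 1, x = s * `|x| & y = s * `|y|].
  have : 0 <= x * y by rewrite -hz sqr_ge0.
  case: (ltgtP x 0) => x0 xy; [exists (-1) | exists 1 | exists (if y < 0 then -1 else 1)].
  - have y0 : y <= 0 by rewrite -(nmulr_rge0 _ x0).
    by rewrite ltr0_norm // ler0_norm //; split=> //; ring.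
  - have y0 : 0 <= y by rewrite -(pmulr_rge0 _ x0).
    by rewrite gtr0_norm // ger0_norm //; split=> //; ring.
  - by rewrite x0 normr0 mulr0; split=> //; case: ifP => // y0; lia.
have : z ^+ 2 = (s * (c * d)) ^+ 2.
  by rewrite hz hx hy hd hc; ring.
move/eqP; rewrite eqf_sqr => /orP[] /eqP ->.
  by exists s, c, d; split=> //; split=> //; rewrite -?hd -?hc.
exists s, (- c), d; split=> //; split; rewrite ?sqrrN -?hd -?hc //; ring.
Qed.

(** A common divisor of the first two entries of an isotropic row divides the third,
    hence the determinant. *)
Lemma isotropic_row_coprime (M : 'M[int]_3) (i : 'I_3) :
  (\det M) ^+ 2 = 1 -> M i 2 ^+ 2 = M i 0 * M i 1 -> coprimez (M i 0) (M i 1).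
Proof.
move=> dM hz; have g0 := dvdz_gcdl (M i 0) (M i 1); have g1 := dvdz_gcdr (M i 0) (M i 1).
rewrite /coprimez; set g := gcdz _ _ in g0 g1 *.
have g2 : (g %| M i 2%R)%Z.
  by rewrite -(@dvdz_pexp2r _ _ 2) // hz expr2 dvdz_mul.
suff h : (g %| 1%R)%Z by move: (h : (g %| 1)%Z); rewrite dvdz1 /g /gcdz absz_nat eqz_nat.
rewrite -dM expr2 dvdz_mulr // (expand_det_row _ i) big_ord3.
by rewrite !rpredD // dvdz_mulr.
Qed.

(** An integral isometry permutes the primitive isotropic vectors, which up to
    sign are the points of the conic with coprime parameters.  The images of
    the two basis vectors on the conic give the substitution, and the third row
    is then determined up to sign by orthogonality. *)
Lemma form_A0_isometry (M : 'M[int]_3) : (\det M) ^+ 2 = 1 ->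
  (forall t, tqf_eval form_A0 (t *m M) = tqf_eval form_A0 t) ->
  exists a b c d s : int, [/\ (a * d - b * c) ^+ 2 = 1, s ^+ 2 = 1 & forall x y,
    conic x y *m M = s *: conic (a * x + c * y) (b * x + d * y)].
Proof.
move=> uM hM.
have hM3 x y z : (x * M 0 2 + y * M 1 2 + z * M 2 2) ^+ 2
   - (x * M 0 0 + y * M 1 0 + z * M 2 0) * (x * M 0 1 + y * M 1 1 + z * M 2 1) = z ^+ 2 - x * y.
  by have := hM (row3 x y z); rewrite mulmx_row3 !form_A0E !row3E.
have iso0 : M 0 2 ^+ 2 = M 0 0 * M 0 1 by have := hM3 1 0 0; lia.
have iso1 : M 1 2 ^+ 2 = M 1 0 * M 1 1 by have := hM3 0 1 0; lia.
have iso2 : M 2 2 ^+ 2 - M 2 0 * M 2 1 = 1 by have := hM3 0 0 1; lia.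
have pol01 : 2 * M 0 2 * M 1 2 - M 0 0 * M 1 1 - M 1 0 * M 0 1 = -1.
  by have := hM3 1 1 0; lia.
have pol02 : 2 * M 0 2 * M 2 2 - M 0 0 * M 2 1 - M 2 0 * M 0 1 = 0.
  by have := hM3 1 0 1; lia.
have pol12 : 2 * M 1 2 * M 2 2 - M 1 0 * M 2 1 - M 2 0 * M 1 1 = 0.
  by have := hM3 0 1 1; lia.
have [s [c [d [s1 [m00 m01 m02]]]]] := conic_point iso0 (isotropic_row_coprime uM iso0).
have [s' [a [b [s1' [m10 m11 m12]]]]] := conic_point iso1 (isotropic_row_coprime uM iso1).
have p01 : s * s' * (a * d - b * c) ^+ 2 = 1.
  by rewrite -[RHS]opprK -[- 1]/(-1) -pol01 m00 m01 m02 m10 m11 m12; ring.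
have ss : s' = s.
  have : 0 <= s * s'.
    rewrite leNgt; apply/negP => ss'; have : s * s' * (a * d - b * c) ^+ 2 <= 0.
      by rewrite nmulr_rle0 // sqr_ge0.
    by rewrite p01.
  move/eqP: s1; rewrite sqrf_eq1 => /orP[] /eqP ->;
  by move/eqP: s1'; rewrite sqrf_eq1 => /orP[] /eqP ->.
have eps1 : (a * d - b * c) ^+ 2 = 1 by move: p01; rewrite ss -expr2 s1 mul1r.
rewrite {}ss in m10 m11 m12 p01 *.
set u1 := M 2 0; set u2 := M 2 1; set u3 := M 2 2.
have q0 : 2 * (c * d) * u3 - d ^+ 2 * u2 - c ^+ 2 * u1 = 0.
  have : s * (2 * (c * d) * u3 - d ^+ 2 * u2 - c ^+ 2 * u1) = 0.
    by rewrite -pol02 m00 m01 m02 -/u1 -/u2 -/u3; ring.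
  by move/(congr1 ( *%R s)); rewrite mulrA -expr2 s1 mul1r mulr0.
have q1 : 2 * (a * b) * u3 - b ^+ 2 * u2 - a ^+ 2 * u1 = 0.
  have : s * (2 * (a * b) * u3 - b ^+ 2 * u2 - a ^+ 2 * u1) = 0.
    by rewrite -pol12 m10 m11 m12 -/u1 -/u2 -/u3; ring.
  by move/(congr1 ( *%R s)); rewrite mulrA -expr2 s1 mul1r mulr0.
(* u1 X^2 - 2 u3 XY + u2 Y^2 vanishes at (c, d) and (a, b), hence is a multiple
   of (d X - c Y) (b X - a Y); the polar form at these points gives the factor. *)
pose mu := u3 * (a * d + b * c) - u1 * a * c - u2 * b * d.
have e1 : u1 = 2 * b * d * mu.
  rewrite -[LHS]mul1r -{1}eps1 -[RHS]addr0 -[0](mulr0 (- (b ^+ 2))) -q0.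
  rewrite -[RHS]addr0 -[0](mulr0 (- (d ^+ 2))) -q1 /mu; ring.
have e2 : u2 = 2 * a * c * mu.
  rewrite -[LHS]mul1r -{1}eps1 -[RHS]addr0 -[0](mulr0 (- (a ^+ 2))) -q0.
  rewrite -[RHS]addr0 -[0](mulr0 (- (c ^+ 2))) -q1 /mu; ring.
have e3 : u3 = (a * d + b * c) * mu.
  rewrite -[LHS]mul1r -{1}eps1 -[RHS]addr0 -[0](mulr0 (- (a * b))) -q0.
  rewrite -[RHS]addr0 -[0](mulr0 (- (c * d))) -q1 /mu; ring.
have mu1 : mu ^+ 2 = 1.
  move: iso2; rewrite -/u1 -/u2 -/u3 e1 e2 e3 => e; rewrite -[LHS]mulr1 -{1}eps1 -[RHS]e; ring.
clearbody mu.
have : (s * mu) ^+ 2 = 1 by rewrite exprMn s1 mu1.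
move/eqP; rewrite sqrf_eq1 => /orP[] /eqP smu.
  have mus : mu = s by rewrite -[mu]mul1r -s1 expr2 -mulrA smu mulr1.
  exists a, b, c, d, s; split=> // x y.
  rewrite /conic mulmx_row3 !row3E m00 m01 m02 m10 m11 m12 -/u1 -/u2 -/u3 e1 e2 e3 mus.
  by rewrite [RHS]row3_eta; congr row3; rewrite !mxE /=; ring.
(* Changing the sign of (a, b) changes only the third row. *)
have mus : mu = - s by rewrite -[mu]mul1r -s1 expr2 -mulrA smu mulrN1.
exists (- a), (- b), c, d, s; split=> // [|x y]; first by rewrite -eps1; ring.
rewrite /conic mulmx_row3 !row3E m00 m01 m02 m10 m11 m12 -/u1 -/u2 -/u3 e1 e2 e3 mus.
by rewrite [RHS]row3_eta; congr row3; rewrite !mxE /=; ring.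
Qed.

(** * Bases of abelian groups and volumes modulo the integers *)

Lemma inj_surj_bij (S T : Type) (f : S -> T) :
  injective f -> (forall y, exists x, f x = y) -> bijective f.
Proof.
move=> fI fS; have [g gP] := @boolp.choice _ _ (fun y x => f x = y) fS.
by exists g => // x; apply: fI; rewrite gP.
Qed.

Section Bases.
Variables (n : nat) (M : zmodType).
Implicit Types (e : n.-tuple M) (c : 'rV[int]_n) (N : 'M[int]_n).

Lemma zlincombB e : {morph zlincomb e : c d / c - d}.
Proof.
by move=> c d; rewrite /zlincomb -sumrB; apply: eq_bigr => i _; rewrite !mxE mulrzBr.
Qed.

HB.instance Definition _ e := GRing.isZmodMorphism.Build _ _ (zlincomb e) (zlincombB e).

Lemma zlincomb_delta e i : zlincomb e (delta_mx 0 i) = tnth e i.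
Proof.
rewrite /zlincomb (bigD1 i) //= big1 => [|j /negPf ji]; rewrite !mxE ?eqxx ?addr0 //=.
by rewrite ji.
Qed.

Lemma zbasisI e : (forall c, zlincomb e c = 0 -> c = 0) ->
  (forall x, exists c, zlincomb e c = x) -> zbasis e.
Proof.
move=> eI; apply: inj_surj_bij => c d /eqP; rewrite -subr_eq0 -raddfB => /eqP/eI/eqP.
by rewrite subr_eq0 => /eqP.
Qed.

Lemma zbasis_co e : zbasis e -> exists co : {additive M -> 'rV[int]_n},
  cancel (zlincomb e) co /\ cancel co (zlincomb e).
Proof.
move=> [co coK eK]; have coB : {morph co : x y / x - y}.
  by move=> x y; rewrite -{1}(eK x) -{1}(eK y) -raddfB coK.
by exists (HB.pack_for {additive M -> 'rV[int]_n} co (GRing.isZmodMorphism.Build _ _ co coB)).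
Qed.

Lemma zcoordK e : zbasis e -> cancel (zlincomb e) (zcoord e).
Proof.
move=> eb c; apply: (bij_inj eb); rewrite /zcoord.
by case: xgetP => [d _ //|/(_ c) []].
Qed.

Definition zbasis_mul N e : n.-tuple M := [tuple zlincomb e (row i N) | i < n].

Lemma zlincomb_mul N e c : zlincomb (zbasis_mul N e) c = zlincomb e (c *m N).
Proof.
rewrite mulmx_sum_row raddf_sum; apply: eq_bigr => i _.
by rewrite tnth_mktuple -[X in X *: row i N]intz scaler_int raddfMz.
Qed.

Lemma zbasis_mulP N e : zbasis e -> N \in unitmx -> zbasis (zbasis_mul N e).
Proof.
move=> [co coK eK] uN; exists (fun x => co x *m invmx N) => [c|x]; rewrite zlincomb_mul.
  by rewrite coK mulmxK.
by rewrite mulmxKV.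
Qed.

Lemma zlincomb_map (M' : zmodType) (h : {additive M -> M'}) e c :
  zlincomb [tuple of map h e] c = h (zlincomb e c).
Proof. by rewrite raddf_sum; apply: eq_bigr => i _; rewrite tnth_map raddfMz. Qed.

End Bases.

Section ModZ.
Variables (R : comNzRingType) (m : nat).
Hypothesis nicR : nic_ring m R.

Lemma nic_intr_inj : injective (intr : int -> R).
Proof.
move=> k l /eqP; rewrite -subr_eq0 -rmorphB; case: nicR => h hb /eqP kl.
have /rV0Pn[i hi] : h 1 != 0 by rewrite (raddf_eq0 _ (bij_inj hb)) oner_eq0.
have : h 1 *~ (k - l) = 0 by rewrite -raddfMz kl raddf0.
move/rowP/(_ i); rewrite -scaler_int !mxE => /eqP; rewrite intz mulf_eq0 (negPf hi) orbF subr_eq0.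
by move/eqP.
Qed.

Lemma modZ_eqP (x y : R) : \pi_(modZ R) x = \pi_(modZ R) y <-> exists k : int, x = y + k%:~R.
Proof.
split=> [e|[k ->]]; last exact: (modZ_eq (n := k)).
have [k hk] := modZ_repr x; have [l hl] := modZ_repr y.
by exists (l - k); rewrite rmorphB addrA -hl -e hk addrK.
Qed.

Variable k : nat.
Implicit Types (a : k.-tuple R) (alpha : k.-tuple (modZ R)).

Lemma zlincomb_cons1 a (c : 'rV[int]_k.+1) :
  zlincomb [tuple of 1 :: a] c
  = (c 0 0)%:~R + zlincomb a (\row_j c 0 (fintype.lift ord0 j)).
Proof.
rewrite /zlincomb big_ord_recl tnth0; congr (_ + _); apply: eq_bigr => i _.
by rewrite tnthS mxE.
Qed.

Lemma zbasis_lift a : zbasis [tuple of map \pi_(modZ R) a] -> zbasis [tuple of 1 :: a].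
Proof.
move=> ab; have [co [coK eK]] := zbasis_co ab; apply: zbasisI => [c|x].
  rewrite zlincomb_cons1 => h; have t0 : \row_j c 0 (fintype.lift ord0 j) = 0.
    apply: (bij_inj ab); rewrite raddf0 zlincomb_map -[RHS](raddf0 \pi_(modZ R)).
    by apply/modZ_eqP; exists (- c 0 0); rewrite add0r rmorphN; apply/eqP; rewrite -addr_eq0 addrC h.
  move: h; rewrite t0 raddf0 addr0 => h0.
  have c0 : c 0 0 = 0 by apply: nic_intr_inj; rewrite h0 mulr0z.
  apply/rowP => j; rewrite mxE.
  by case: (unliftP ord0 j) => [i ->|->//]; move/rowP: t0 => /(_ i); rewrite !mxE.
have : \pi_(modZ R) x = \pi_(modZ R) (zlincomb a (co (\pi_(modZ R) x))).
  by rewrite -zlincomb_map eK.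
case/modZ_eqP => l hl; exists (\row_j if unlift ord0 j is Some i then co (\pi_(modZ R) x) 0 i else l).
rewrite zlincomb_cons1 mxE unlift_none [RHS]hl addrC; congr (zlincomb _ _ + _).
by apply/rowP => i; rewrite !mxE liftK.
Qed.

Lemma zbasis_repr alpha : zbasis alpha -> zbasis [tuple of 1 :: [seq repr z | z <- alpha]].
Proof.
move=> ab; apply: (@zbasis_lift [tuple of [seq repr z | z <- alpha]]).
congr zbasis: ab; apply: eq_from_tnth => i; by rewrite !tnth_map reprK.
Qed.

(** In the basis made of 1 and lifts of alpha, the coordinate matrix of 1, x is
    block triangular: the wedge product with 1 only sees classes modulo Z. *)
Lemma wedge_cons1 alpha (x : k.-tuple R) (N : 'M[int]_k) : zbasis alpha ->
  (forall i, \pi_(modZ R) (tnth x i) = zlincomb alpha (row i N)) ->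
  wedge [tuple of 1 :: x] = wedge1 alpha *~ \det N.
Proof.
move=> ab hx; have [co [coK eK]] := zbasis_co (zbasis_repr ab).
pose e := [tuple of 1 :: [seq repr z | z <- alpha]].
have co_e i j : co (tnth e i) 0 j = (i == j)%:R.
  by rewrite -(zlincomb_delta e) coK mxE eqxx eq_sym.
rewrite -[LHS](ext_volK eK co_e); congr (_ *~ _).
rewrite ext_vol_wedge (expand_det_row _ ord0) big_ord_recl big1 => [|j _]; last first.
  by rewrite !mxE tnth0 -[1](tnth0 1 [tuple of [seq repr z | z <- alpha]]) co_e mul0r.
rewrite !mxE tnth0 -[X in co X](tnth0 1 [tuple of [seq repr z | z <- alpha]]) co_e mul1r addr0.
rewrite /cofactor expr0 mul1r; congr (\det _); apply/matrixP => i j; rewrite !mxE tnthS.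
have [l ->] : exists l : int, tnth x i = l%:~R + zlincomb [tuple of [seq repr z | z <- alpha]] (row i N).
  have /modZ_eqP[l hl] : \pi_(modZ R) (tnth x i)
      = \pi_(modZ R) (zlincomb [tuple of [seq repr z | z <- alpha]] (row i N)).
    rewrite hx -zlincomb_map; congr (zlincomb _ _).
    by apply: eq_from_tnth => s; rewrite !tnth_map /= reprK.
  by exists l; rewrite addrC.
pose c : 'rV[int]_k.+1 := \row_j if unlift ord0 j is Some s then N i s else l.
have -> : l%:~R + zlincomb [tuple of [seq repr z | z <- alpha]] (row i N) = zlincomb e c.
  rewrite zlincomb_cons1 mxE unlift_none; congr (_ + zlincomb _ _).
  by apply/rowP => s; rewrite !mxE liftK.
by rewrite coK mxE liftK.
Qed.

Lemma wedge1_mul alpha (N : 'M[int]_k) : zbasis alpha ->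
  wedge1 (zbasis_mul N alpha) = wedge1 alpha *~ \det N.
Proof.
move=> ab; apply: (wedge_cons1 (x := [tuple of [seq repr z | z <- zbasis_mul N alpha]])) => // i.
by rewrite tnth_map reprK tnth_mktuple.
Qed.

(** The top exterior power is torsion free: its volume form takes the value 1
    on the wedge of a basis. *)
Lemma wedge1_inj alpha : zbasis alpha -> injective (fun l : int => wedge1 alpha *~ l).
Proof.
move=> ab l l' h; have [co [coK eK]] := zbasis_co (zbasis_repr ab).
pose e := [tuple of 1 :: [seq repr z | z <- alpha]].
have co_e i j : co (tnth e i) 0 j = (i == j)%:R.
  by rewrite -(zlincomb_delta e) coK mxE eqxx eq_sym.
by move: (congr1 (ext_vol co) h); rewrite /= !raddfMz /= (ext_vol_basis co_e) !intz.
Qed.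

End ModZ.

(** * Binary forms *)

Lemma bcf_ext g g' : (forall x y : int, bcf_eval g x y = bcf_eval g' x y) -> g = g'.
Proof.
move=> h; have := h 1 0; have := h 0 1; have := h 1 1; have := h 1 (-1).
case: g h => a b c d h; case: g' h => a' b' c' d' _.
rewrite /bcf_eval /= !intz => h1 h2 h3 h4.
by congr BCF; lia.
Qed.

Lemma bqf_ext f g : (forall x y : int, bqf_eval f x y = bqf_eval g x y) -> f = g.
Proof.
move=> h; have := h 1 0; have := h 0 1; have := h 1 1; have := h 1 (-1); have := h 1 2.
case: f h => a b c d e h; case: g h => a' b' c' d' e' _.
rewrite /bqf_eval /= !intz => h1 h2 h3 h4 h5.
by congr BQF; lia.
Qed.

Lemma bcf_eval_rmorph (K L : comNzRingType) (h : {rmorphism K -> L}) g x y :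
  h (bcf_eval g x y) = bcf_eval g (h x) (h y).
Proof. by rewrite /bcf_eval !(rmorphD, rmorphXn, rmorphM, rmorph_int). Qed.

Lemma bqf_eval_rmorph (K L : comNzRingType) (h : {rmorphism K -> L}) f x y :
  h (bqf_eval f x y) = bqf_eval f (h x) (h y).
Proof. by rewrite /bqf_eval !(rmorphD, rmorphXn, rmorphM, rmorph_int). Qed.

(** The form e g (p x + r y, q x + s y). *)
Definition bcf_act (e p q r s : int) (g : bcf) : bcf :=
  let a := ca g in let b := cb g in let c := cc g in let d := cd g in
  BCF (e * (a * p ^+ 3 + b * p ^+ 2 * q + c * p * q ^+ 2 + d * q ^+ 3))
      (e * (3 * a * p ^+ 2 * r + b * (p ^+ 2 * s + 2 * p * q * r)
            + c * (2 * p * q * s + q ^+ 2 * r) + 3 * d * q ^+ 2 * s))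
      (e * (3 * a * p * r ^+ 2 + b * (q * r ^+ 2 + 2 * p * r * s)
            + c * (p * s ^+ 2 + 2 * q * r * s) + 3 * d * q * s ^+ 2))
      (e * (a * r ^+ 3 + b * r ^+ 2 * s + c * r * s ^+ 2 + d * s ^+ 3)).

Lemma bcf_actE e p q r s g (x y : int) :
  bcf_eval (bcf_act e p q r s g) x y = e * bcf_eval g (p * x + r * y) (q * x + s * y).
Proof. by rewrite /bcf_eval /bcf_act /= !intz; ring. Qed.

(** Covariance of the associated form: the lifts of the new basis with product
    in Z are found by solving a linear system of determinant [e]. *)
Lemma associated_cubic_form_act (C : comNzRingType) (om th : modZ C) g e p q r s :
  p * s = e + q * r -> e ^+ 2 = 1 -> associated_cubic_form om th g ->
  associated_cubic_form (om *~ p + th *~ q) (om *~ r + th *~ s) (bcf_act e p q r s g).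
Proof.
move=> he e1 [w [t [<- <- wt ww tt]]].
case: g wt ww tt => a b c d /= wt ww tt.
pose u := p * r * b + q * s * d; pose v := - (p * r * a) - q * s * c.
(* The integral shifts that put w' t' in Z. *)
pose n1 := e * (u * q - v * p); pose n2 := e * (v * r - u * s).
pose w' := w *~ p + t *~ q + n1%:~R; pose t' := w *~ r + t *~ s + n2%:~R.
have piz (x : C) (k : int) : \pi_(modZ C) (x + k%:~R) = \pi_(modZ C) x.
  by apply: (modZ_eq (n := k)).
(* Structure constants of products of linear combinations of w and t. *)
pose K p q r s : int := p * r * (- (a * c)) + (p * s + q * r) * (- (a * d)) + q * s * (- (b * d)).
pose L p q r s : int := p * r * b + q * s * d.
pose M p q r s : int := - (p * r * a) - q * s * c.
have prodE p1 q1 m1 p2 q2 m2 :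
  (w *~ p1 + t *~ q1 + m1%:~R) * (w *~ p2 + t *~ q2 + m2%:~R)
  = (K p1 q1 p2 q2 + m1 * m2)%:~R + w *~ (L p1 q1 p2 q2 + p1 * m2 + m1 * p2)
    + t *~ (M p1 q1 p2 q2 + q1 * m2 + m1 * q2).
  transitivity (w ^+ 2 *~ (p1 * p2) + t ^+ 2 *~ (q1 * q2) + (w * t) *~ (p1 * q2 + q1 * p2)
     + w *~ (p1 * m2 + m1 * p2) + t *~ (q1 * m2 + m1 * q2) + (m1 * m2)%:~R).
    by ring.
  by rewrite wt ww tt /K /L /M; ring.
have lin (k l m k' l' m' : int) : k = k' -> l = l' -> m = m' ->
    k%:~R + w *~ l + t *~ m = k'%:~R + w *~ l' + t *~ m' by move=> -> -> ->.
have eE : e = p * s - q * r by rewrite he addrK.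
(* Multiplying the quadratic terms by e ^ 2 = 1 makes the identities homogeneous. *)
have e2 (x : int) : x = e ^+ 2 * x by rewrite e1 mul1r.
exists w', t'; split.
- by rewrite piz raddfD !raddfMz.
- by rewrite piz raddfD !raddfMz.
- rewrite prodE -[RHS]addr0 -(mulr0z w) -[RHS]addr0 -(mulr0z t).
  by apply: lin; [rewrite (e2 (K _ _ _ _)) (e2 (_ * K _ _ _ _))
    | rewrite (e2 (L _ _ _ _)) | rewrite (e2 (M _ _ _ _))];
    rewrite /K /L /M /n1 /n2 /u /v eE /=; ring.
- rewrite expr2 prodE; set g' := bcf_act _ _ _ _ _ _.
  transitivity ((- (ca g' * cc g') + cb g' * n1 - ca g' * n2)%:~R
      + w *~ (cb g' * p - ca g' * r) + t *~ (cb g' * q - ca g' * s)); last by rewrite /w' /t'; ring.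
  by apply: lin; [rewrite (e2 (K _ _ _ _)) (e2 (_ * K _ _ _ _))
    | rewrite (e2 (L _ _ _ _)) | rewrite (e2 (M _ _ _ _))];
    rewrite /K /L /M /n1 /n2 /u /v /g' eE /=; ring.
- rewrite expr2 prodE; set g' := bcf_act _ _ _ _ _ _.
  transitivity ((- (cb g' * cd g') + cd g' * n1 - cc g' * n2)%:~R
      + w *~ (cd g' * p - cc g' * r) + t *~ (cd g' * q - cc g' * s)); last by rewrite /w' /t'; ring.
  by apply: lin; [rewrite (e2 (K _ _ _ _)) (e2 (_ * K _ _ _ _))
    | rewrite (e2 (L _ _ _ _)) | rewrite (e2 (M _ _ _ _))];
    rewrite /K /L /M /n1 /n2 /u /v /g' eE /=; ring.
Qed.

(** * Bases adapted to a cubic resolvent *)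

Definition tqf_comb (x : int) (A : tqf) (y : int) (B : tqf) : tqf :=
  TQF (x * q11 A + y * q11 B) (x * q22 A + y * q22 B) (x * q33 A + y * q33 B)
      (x * q12 A + y * q12 B) (x * q13 A + y * q13 B) (x * q23 A + y * q23 B).

Lemma tqf_combE x A y B t :
  tqf_eval (tqf_comb x A y B) t = x * tqf_eval A t + y * tqf_eval B t.
Proof. by rewrite /tqf_eval /=; ring. Qed.

Lemma tqf_gram_comb x A y B :
  tqf_gram (tqf_comb x A y B) = x *: tqf_gram A + y *: tqf_gram B.
Proof.
by apply/matrixP => [[[|[|[|i]]] //= hi] [[|[|[|j]]] //= hj]]; rewrite !mxE /=; ring.
Qed.

Definition mx2 (p q r s : int) : 'M[int]_2 :=
  \matrix_(i < 2, j < 2) nth 0 (nth [::] [:: [:: p; q]; [:: r; s]] i) j.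

Lemma det_mx2 p q r s : \det (mx2 p q r s) = p * s - q * r.
Proof. by rewrite det_mx22 !mxE. Qed.

Lemma zlincomb2 (M : zmodType) (x y : M) (c : 'rV[int]_2) :
  zlincomb [tuple x; y] c = x *~ c 0 0 + y *~ c 0 1.
Proof.
rewrite /zlincomb !big_ord_recl big_ord0 addr0 !(tnth_nth 0) /=.
by congr (_ *~ c _ _ + _ *~ c _ _); apply: val_inj.
Qed.

Lemma zlincomb3 (M : zmodType) (x y z : M) (c : 'rV[int]_3) :
  zlincomb [tuple x; y; z] c = x *~ c 0 0 + y *~ c 0 1 + z *~ c 0 2.
Proof. by rewrite /zlincomb big_ord3 !(tnth_nth 0). Qed.

Lemma zbasis_mul2 (M : zmodType) (x y : M) p q r s :
  zbasis_mul (mx2 p q r s) [tuple x; y] = [tuple x *~ p + y *~ q; x *~ r + y *~ s].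
Proof.
apply: eq_from_tnth => i; rewrite tnth_mktuple zlincomb2 !mxE.
by case: i => [[|[|i]] //= hi]; rewrite (tnth_nth 0).
Qed.

(** The equation g = 4 Det (A x - B y), doubled so that 8 = 2^3 is absorbed in
    the integral Gram matrices. *)
Definition det_form (A B : tqf) (g : bcf) : Prop :=
  forall x y : int, 2 * bcf_eval g x y = \det (x *: tqf_gram A - y *: tqf_gram B).

Lemma four_det_det_form A B g :
  four_det A B = bcf_eval g 'X ('X)%:P -> det_form A B g.
Proof.
move=> h x y; apply: (@intr_inj rat).
pose ev : {rmorphism {poly {poly rat}} -> rat} :=
  (horner_eval (y%:~R : rat) \o horner_eval ((x%:~R : rat)%:P))%FUN.
have evX : ev 'X = x%:~R by rewrite /ev /= /horner_eval hornerX hornerC.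
have evY : ev ('X)%:P = y%:~R by rewrite /ev /= /horner_eval hornerC hornerX.
have evC (c : rat) : ev (c%:P%:P) = c by rewrite /ev /= /horner_eval !hornerC.
move/(congr1 ev): h; rewrite bcf_eval_rmorph evX evY /four_det rmorphM rmorph_nat -det_map_mx.
have -> : map_mx ev ('X *: map_mx (fun r : rat => r%:P%:P) (tqf_mx A)
            - ('X)%:P *: map_mx (fun r : rat => r%:P%:P) (tqf_mx B))
   = x%:~R *: tqf_mx A - y%:~R *: tqf_mx B.
  rewrite map_mxB !map_mxZ evX evY -!map_mx_comp.
  by rewrite !(map_mx_id (f := ev \o _)) //= => c; rewrite /= evC.
have hG q : map_mx intr (tqf_gram q) = 2 *: tqf_mx q :> 'M[rat]_3.
  apply/matrixP => [[[|[|[|i]]] //= hi] [[|[|[|j]]] //= hj]]; rewrite !mxE /= ?rmorphM //;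
    by rewrite mulrCA divff // mulr1.
rewrite rmorphM /= (bcf_eval_rmorph (intr : {rmorphism int -> rat})) => <-.
rewrite -(det_map_mx intr) map_mxB !map_mxZ !hG !scalerA ![_ * 2]mulrC -!scalerA -scalerBr.
by rewrite detZ; ring.
Qed.

Lemma det_form_uniq A B g g' : det_form A B g -> det_form A B g' -> g = g'.
Proof.
by move=> h h'; apply: bcf_ext => x y; apply: (@mulfI int 2) => //; rewrite h h'.
Qed.

Lemma det_form_leading A B g : det_form A B g -> ca g = tqf_det4 A.
Proof.
move=> /(_ 1 0); rewrite scale1r scale0r subr0 det_tqf_gram => /(@mulfI int 2) <- //.
by rewrite /bcf_eval !intz; ring.
Qed.

Lemma det_form_resolvent f : det_form form_A0 (form_B f) (resolvent_bcf f).
Proof. exact/four_det_det_form/four_det_of. Qed.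

Section Adapted.
Variables (Q C : comNzRingType) (phi : modZ Q -> modZ C).
Variable delta : {additive extpow 4 Q -> extpow 3 C}.
Hypotheses (nicQ : nic_ring 4 Q) (nicC : nic_ring 3 C).

Record adapted (alpha : 3.-tuple (modZ Q)) (om th : modZ C) (A B : tqf) (g : bcf) : Prop :=
  Adapted {
    ad_alpha : zbasis alpha;
    ad_omega : zbasis [tuple om; th];
    ad_delta : delta (wedge1 alpha) = wedge1 [tuple om; th];
    ad_phi : forall t, phi (zlincomb alpha t) = om *~ tqf_eval B t + th *~ tqf_eval A t;
    ad_det : det_form A B g;
    ad_form : associated_cubic_form om th g
  }.

Lemma resolvent_form_adapted : resolvent_form_condition phi delta ->
  exists alpha om th A B g, adapted alpha om th A B g.
Proof.
move=> [alpha [om [th [A [B [g [[h1 h2] [h3 h4 h5 h6]]]]]]]].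
by exists alpha, om, th, A, B, g; split=> //; apply: four_det_det_form.
Qed.

(** Simultaneous changes of basis of Q/Z and C/Z whose determinants are the same
    sign [e], so that delta still matches the two volume forms.  The new A and B
    come from inverting the change of basis of C/Z. *)
Lemma adapted_change alpha om th A B g (N : 'M[int]_3) e p q r s :
  adapted alpha om th A B g -> \det N = e -> p * s = e + q * r -> e ^+ 2 = 1 ->
  adapted (zbasis_mul N alpha) (om *~ p + th *~ q) (om *~ r + th *~ s)
    (tqf_pull N (tqf_comb (e * p) A (- (e * q)) B))
    (tqf_pull N (tqf_comb (e * s) B (- (e * r)) A))
    (bcf_act e p q r s g).
Proof.
move=> [ha ho hd hp hg hf] dN he e1.
have eE : e = p * s - q * r by rewrite he addrK.
have ue : e \is a GRing.unit by apply/unitrP; exists e; rewrite -expr2 e1.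
have uN : N \in unitmx by rewrite unitmxE dN.
have uM : mx2 p q r s \in unitmx by rewrite unitmxE det_mx2 -eE.
split.
- exact: zbasis_mulP.
- by rewrite -zbasis_mul2; apply: zbasis_mulP.
- by rewrite (wedge1_mul nicQ) // raddfMz /= hd -zbasis_mul2 (wedge1_mul nicC) // det_mx2 dN eE.
- move=> t; rewrite zlincomb_mul hp !tqf_pullE !tqf_combE.
  move: (tqf_eval B _) (tqf_eval A _) => b a.
  rewrite !mulrzDl -!mulrzA addrACA -!mulrzDr; congr (_ *~ _ + _ *~ _).
    by rewrite -[LHS]mul1r -e1 expr2 {2}eE; ring.
  by rewrite -[LHS]mul1r -e1 expr2 {2}eE; ring.
- move=> x y; rewrite bcf_actE mulrCA hg.
  have G X := tqf_gram_pull (tqf_pullE N X).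
  have H (X Y : 'M[int]_3) : x *: (N *m X *m N^T) - y *: (N *m Y *m N^T) = N *m (x *: X - y *: Y) *m N^T.
    by rewrite mulmxBr mulmxBl -!scalemxAr -!scalemxAl.
  rewrite !G !tqf_gram_comb H !det_mulmx det_tr dN.
  rewrite [in RHS](_ : x *: _ - y *: _
    = e *: ((p * x + r * y) *: tqf_gram A - (q * x + s * y) *: tqf_gram B)).
    have e3 : e ^+ 3 = e by rewrite exprS e1 mulr1.
    by rewrite detZ e3; move: (\det _) => D; rewrite -[LHS]mul1r -e1; ring.
  by apply/matrixP => i j; rewrite !mxE; ring.
- exact: associated_cubic_form_act.
Qed.

End Adapted.

(** * Normal form of a monogenized resolvent *)

Lemma tqf_ext q q' : tqf_eval q =1 tqf_eval q' -> q = q'.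
Proof.
move=> h; have := h (row3 1 0 0); have := h (row3 0 1 0); have := h (row3 0 0 1).
have := h (row3 1 1 0); have := h (row3 1 0 1); have := h (row3 0 1 1).
case: q h => a b c d e f h; case: q' h => a' b' c' d' e' f' _.
rewrite /tqf_eval /= !row3E => h1 h2 h3 h4 h5 h6.
by congr TQF; lia.
Qed.

Section Generator.
Variables (C : comNzRingType) (om : modZ C).
Hypothesis omP : monogenized_by om.

(** Induction on polynomials in an arbitrary lift of the generator. *)
Lemma monogenic_ind (w : C) (S : C -> Prop) : \pi_(modZ C) w = om ->
  S 1 -> (forall x y, S x -> S y -> S (x + y)) -> (forall x (k : int), S x -> S (x *~ k)) ->
  (forall x, S x -> S (w * x)) -> forall x, S x.
Proof.
move=> hw S1 SD SM Sw x; have [p ->] := omP x.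
have [n ->] : exists n : int, repr om = w + n%:~R by rewrite -hw; apply: modZ_repr.
elim/poly_ind: p => [|p c IH].
  by rewrite map_poly0 horner0 -(mulr0z 1); apply: SM.
rewrite rmorphD rmorphM /= map_polyX map_polyC hornerMXaddC mulrDr mulrC.
apply: (SD); last exact: SM.
by apply: (SD); [apply: Sw | rewrite mulrzr; apply: SM].
Qed.

Variable th : modZ C.

(** If d divides both coordinates, then Z[omega] lies in Z + d C. *)
Lemma monogenic_primitive (om0 : modZ C) (p q : int) :
  zbasis [tuple om0; th] -> om = om0 *~ p + th *~ q -> coprimez p q.
Proof.
move=> ob hom; have /dvdzP[p' hp] := dvdz_gcdl p q; have /dvdzP[q' hq] := dvdz_gcdr p q.
rewrite /coprimez; set d := gcdz p q in hp hq *.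
pose y : C := repr om0 *~ p' + repr th *~ q'.
have hw : \pi_(modZ C) (y *~ d) = om.
  by rewrite hom raddfMz raddfD !raddfMz /= !reprK mulrzDl -!mulrzA -hp -hq.
have [k [x hx]] : exists (k : int) (x : C), repr om0 = k%:~R + x *~ d.
  apply: (monogenic_ind (S := fun z => exists (k : int) (x : C), z = k%:~R + x *~ d) hw).
  - by exists 1, 0; rewrite mul0rz addr0.
  - move=> _ _ [k [x ->]] [l [z ->]]; exists (k + l), (x + z).
    by rewrite rmorphD mulrzDl /= addrACA.
  - move=> _ l [k [x ->]]; exists (k * l), (x *~ l).
    by rewrite mulrzDl -!mulrzA [l * d]mulrC.
  - move=> _ [k [x ->]]; exists 0, (y *~ k + y * x *~ d); ring.
have [co [coK eK]] := zbasis_co ob.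
have : om0 = \pi_(modZ C) x *~ d.
  rewrite -[LHS]reprK hx -raddfMz; apply: (modZ_eq (n := k)); exact: addrC.
have e0 : om0 = zlincomb [tuple om0; th] (delta_mx 0 0) by rewrite zlincomb_delta.
move/(congr1 co); rewrite {1}e0 coK raddfMz /= => /rowP/(_ 0).
rewrite -scaler_int !mxE eqxx /= intz => h.
suff h1 : (d %| 1%R)%Z by move: (h1 : (d %| 1)%Z); rewrite dvdz1 /d /gcdz absz_nat eqz_nat.
by apply/dvdzP; exists (co (\pi_(modZ C) x) 0 0); rewrite [RHS]mulrC -h.
Qed.

(** Up to sign the leading coefficient a is the index of Z[omega]: the subgroup
    Z + Z w + a Z t is stable under multiplication by w, hence contains t. *)
Lemma monogenic_leading g : zbasis [tuple om; th] -> associated_cubic_form om th g ->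
  (ca g) ^+ 2 = 1.
Proof.
move=> ob [w [t [hw ht wt ww _]]].
have [k [l [m hx]]] : exists k l m : int, t = k%:~R + w *~ l + t *~ (ca g * m).
  apply: (monogenic_ind (S := fun z => exists k l m : int, z = k%:~R + w *~ l + t *~ (ca g * m)) hw).
  - by exists 1, 0, 0; rewrite mulr0 !mulr0z !addr0.
  - move=> _ _ [k [l [m ->]]] [k' [l' [m' ->]]]; exists (k + k'), (l + l'), (m + m'); ring.
  - move=> _ n [k [l [m ->]]]; exists (k * n), (l * n), (m * n); ring.
  - move=> _ [k [l [m ->]]]; exists (- (ca g * cc g) * l - ca g * cd g * (ca g * m)), (k + cb g * l), (- l).
    transitivity (w *~ k + w ^+ 2 *~ l + (w * t) *~ (ca g * m)); first by ring.
    by rewrite ww wt; ring.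
have [co [coK eK]] := zbasis_co ob.
have e1 : th = zlincomb [tuple om; th] (delta_mx 0 1) by rewrite zlincomb_delta.
have e2 : om *~ l + th *~ (ca g * m) = zlincomb [tuple om; th] (\row_j [:: l; ca g * m]`_j).
  by rewrite zlincomb2 !mxE.
have : th = om *~ l + th *~ (ca g * m).
  rewrite -[LHS]ht hx -addrA addrC -ht -hw -!raddfMz -raddfD.
  by apply: (modZ_eq (n := k)).
rewrite e2 {1}e1 => /(congr1 co); rewrite !coK => /rowP/(_ 1); rewrite !mxE /= => h.
have : (ca g %| 1%R)%Z by apply/dvdzP; exists m; rewrite mulrC -h.
by move=> h1; move: (h1 : (ca g %| 1)%Z); rewrite dvdz1 => /eqP h2;
  have [->|->] : ca g = 1 \/ ca g = -1 by lia.
Qed.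

End Generator.

Section NormalForm.
Variables (Q C : comNzRingType) (phi : modZ Q -> modZ C).
Variable delta : {additive extpow 4 Q -> extpow 3 C}.
Hypotheses (nicQ : nic_ring 4 Q) (nicC : nic_ring 3 C).

Lemma form_B_conic f x y : tqf_eval (form_B f) (conic x y) = bqf_eval f x y.
Proof. by rewrite /tqf_eval /conic !row3E /bqf_eval /= !intz; ring. Qed.

Lemma form_A0_conic x y : tqf_eval form_A0 (conic x y) = 0.
Proof. by rewrite form_A0E exprMn mulrC subrr. Qed.

(** Once A = A0, adding a multiple of omega to theta clears the coefficient q12
    of B; the resulting quartic form is the restriction of B to the conic. *)
Lemma adapted_form_B alpha (om th : modZ C) B g :
  adapted phi delta alpha om th form_A0 B g ->
  exists f alpha' th',
    adapted phi delta alpha' om th' form_A0 (form_B f) (resolvent_bcf f) /\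
    forall x y : int, bqf_eval f x y = tqf_eval B (conic x y).
Proof.
move=> had; pose B' := tqf_comb 1 B (q12 B) form_A0.
pose f := BQF (q22 B') (q23 B') (q33 B') (q13 B') (q11 B').
have fB : form_B f = B'.
  by rewrite /f /B' /form_B /form_A0 /=; congr TQF; rewrite /=; ring.
have had' := adapted_change nicQ nicC (N := 1%:M) (p := 1) (q := 0) (r := - q12 B) (s := 1)
  had (det1 _ _) ltac:(by ring) ltac:(by []).
have A3 : tqf_pull 1%:M (tqf_comb (1 * 1) form_A0 (- (1 * 0)) B) = form_A0.
  by apply: tqf_ext => t; rewrite tqf_pullE tqf_combE mulmx1; ring.
have B3 : tqf_pull 1%:M (tqf_comb (1 * 1) B (- (1 * - q12 B)) form_A0) = form_B f.
  by rewrite fB; apply: tqf_ext => t; rewrite tqf_pullE !tqf_combE mulmx1; ring.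
rewrite mulr1z mulr0z addr0 A3 B3 in had'.
have gE := det_form_uniq (det_form_resolvent f) (ad_det had').
rewrite -gE in had'.
exists f; do 2 eexists; split=> [|x y]; first exact: had'.
by rewrite -form_B_conic fB tqf_combE form_A0_conic mul1r mulr0 addr0.
Qed.

(** Complete the generator to a basis of C/Z, fix the
    orientation so that 4 Det A = -1, reduce A to A0, and clear the entry q12
    of B by adding a multiple of omega to theta. *)
Lemma adapted_normal_form om : resolvent_form_condition phi delta -> monogenized_by om ->
  exists f alpha th, adapted phi delta alpha om th form_A0 (form_B f) (resolvent_bcf f).
Proof.
move=> /resolvent_form_adapted [al0 [om0 [th0 [A0 [B0 [g0 had0]]]]]] hom.
have change := @adapted_change Q C phi delta nicQ nicC.
have [p [q hpq]] : exists p q, om = om0 *~ p + th0 *~ q.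
  have [co [_ eK]] := zbasis_co (ad_omega had0).
  by exists (co om 0 0), (co om 0 1); rewrite -zlincomb2 eK.
have /coprimezP[[s r] /= hrs] := monogenic_primitive hom (ad_omega had0) hpq.
have had1 := change _ _ _ _ _ _ 1%:M 1 p q (- r) s had0 (det1 _ _) ltac:(lia) ltac:(by []).
rewrite -hpq in had1.
set al1 := zbasis_mul _ _ in had1; set th1 := _ *~ _ + _ in had1.
set A1 := tqf_pull _ _ in had1; set B1 := tqf_pull _ _ in had1; set g1 := bcf_act _ _ _ _ _ _ in had1.
clearbody al1 th1 A1 B1 g1; clear p q s r hrs hpq had0.
have [al [th [A [B [g [had hA]]]]]] : exists al th A B g,
    adapted phi delta al om th A B g /\ tqf_det4 A = -1.
  have := monogenic_leading hom (ad_omega had1) (ad_form had1).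
  move/eqP; rewrite sqrf_eq1 => /orP[] /eqP ha; last first.
    by exists al1, th1, A1, B1, g1; split=> //; rewrite -(det_form_leading (ad_det had1)).
  have dN : \det (- 1%:M : 'M[int]_3) = -1 by rewrite -scaleN1r detZ det1 mulr1.
  have had := change _ _ _ _ _ _ _ (-1) 1 0 0 (-1) had1 dN ltac:(by []) ltac:(by []).
  rewrite mulr1z mulr0z addr0 in had.
  do 5 eexists; split; first exact: had.
  by rewrite -(det_form_leading (ad_det had)) /= ha; lia.
have [M dM hM] := tqf_unimodular hA.
have had2 := change _ _ _ _ _ _ M 1 1 0 0 1 had dM ltac:(by []) ltac:(by []).
rewrite !mulr1z !mulr0z addr0 add0r in had2.
have A2 : tqf_pull M (tqf_comb (1 * 1) A (- (1 * 0)) B) = form_A0.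
  by apply: tqf_ext => t; rewrite tqf_pullE tqf_combE hM; ring.
rewrite A2 in had2; have [f [al' [th' [hf _]]]] := adapted_form_B had2.
by exists f, al', th'.
Qed.

End NormalForm.

(** * The quartic ring is determined by its resolvent *)

Lemma modZ_map_pi (R S : comNzRingType) (h : {rmorphism R -> S}) x :
  modZ_map h (\pi_(modZ R) x) = \pi_(modZ S) (h x).
Proof.
rewrite /modZ_map; have [n ->] := modZ_repr x.
by apply: (modZ_eq (n := n)); rewrite rmorphD rmorph_int.
Qed.

Lemma modZ_mapB (R S : comNzRingType) (h : {rmorphism R -> S}) :
  {morph modZ_map h : x y / x - y}.
Proof.
by move=> x y; rewrite -(reprK x) -(reprK y) -modZ_piB !modZ_map_pi rmorphB modZ_piB.
Qed.

HB.instance Definition _ (R S : comNzRingType) (h : {rmorphism R -> S}) :=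
  GRing.isZmodMorphism.Build (modZ R) (modZ S) (modZ_map h) (modZ_mapB h).

Section Structure.
Variables (Q C : comNzRingType) (phi : modZ Q -> modZ C).
Variable delta : {additive extpow 4 Q -> extpow 3 C}.
Hypotheses (nicQ : nic_ring 4 Q) (nicC : nic_ring 3 C).
Hypothesis delta_phi : forall x y : Q, delta (wedge [tuple 1; x; y; x * y])
  = wedge1 [tuple phi (\pi_(modZ Q) x); phi (\pi_(modZ Q) y)].
Variables (alpha : 3.-tuple (modZ Q)) (om th : modZ C) (A B : tqf) (g : bcf).
Hypothesis had : adapted phi delta alpha om th A B g.

(** The resolvent condition on 1 /\ x /\ y /\ xy, read through the volume forms. *)
Lemma adapted_structure (x y : Q) (X Y Z : 'rV[int]_3) :
  \pi_(modZ Q) x = zlincomb alpha X -> \pi_(modZ Q) y = zlincomb alpha Y ->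
  \pi_(modZ Q) (x * y) = zlincomb alpha Z ->
  \det (mx3 0 [:: [:: X 0 0; X 0 1; X 0 2]; [:: Y 0 0; Y 0 1; Y 0 2];
                  [:: Z 0 0; Z 0 1; Z 0 2]])
  = tqf_eval B X * tqf_eval A Y - tqf_eval A X * tqf_eval B Y.
Proof.
move=> hX hY hZ; set N := mx3 _ _; apply: (wedge1_inj nicC (ad_omega had)).
have := delta_phi x y; rewrite hX hY !(ad_phi had) -zbasis_mul2.
rewrite (wedge1_mul nicC _ (ad_omega had)) det_mx2 => <-.
have -> : [tuple 1; x; y; x * y] = [tuple of 1 :: [tuple x; y; x * y]] by apply: val_inj.
rewrite (wedge_cons1 nicQ (N := N) (ad_alpha had)) ?raddfMz /= ?(ad_delta had) //.
move=> i; have rowE (t : 'rV[int]_3) : (forall j, N i j = t 0 j) -> row i N = t.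
  by move=> h; apply/rowP => j; rewrite mxE h.
by case: i rowE => [[|[|[|i]]] //= hi] rowE; rewrite (tnth_nth 0) /= ?hX ?hY ?hZ;
  congr (zlincomb _ _); symmetry; apply: rowE; case=> [[|[|[|j]]] //= hj]; rewrite mxE /=;
  congr (_ _ _); apply: val_inj.
Qed.

End Structure.

(** The identity det (x, y, xy) = B(x) A(y) - A(x) B(y), sampled at small
    vectors, determines the multiplication table modulo constants once the
    lifts are normalized by c12_1 = c12_2 = c13_1 = 0.  Here cij is the
    product of the i-th and j-th basis vectors. *)
Lemma structure_constants f (c11 c22 c33 c12 c13 c23 : 'rV[int]_3) :
  (forall X Y : 'rV[int]_3,
     let Z l := c11 0 l * (X 0 0 * Y 0 0) + c22 0 l * (X 0 1 * Y 0 1) + c33 0 l * (X 0 2 * Y 0 2)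
       + c12 0 l * (X 0 0 * Y 0 1 + X 0 1 * Y 0 0) + c13 0 l * (X 0 0 * Y 0 2 + X 0 2 * Y 0 0)
       + c23 0 l * (X 0 1 * Y 0 2 + X 0 2 * Y 0 1) in
     \det (mx3 0 [:: [:: X 0 0; X 0 1; X 0 2]; [:: Y 0 0; Y 0 1; Y 0 2]; [:: Z 0; Z 1; Z 2]])
     = tqf_eval (form_B f) X * tqf_eval form_A0 Y - tqf_eval form_A0 X * tqf_eval (form_B f) Y) ->
  c12 0 0 = 0 -> c12 0 1 = 0 -> c13 0 0 = 0 ->
  [/\ c11 = row3 (f3 f) 0 (- f4 f), c22 = row3 0 (- f1 f) (f0 f)
    & c33 = row3 (f1 f) (- f3 f) (- f2 f)] /\
  [/\ c12 = 0, c13 = row3 0 (- f4 f) 0 & c23 = row3 (f0 f) (- f2 f) 0].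
Proof.
rewrite [c11]row3_eta [c22]row3_eta [c33]row3_eta [c12]row3_eta [c13]row3_eta [c23]row3_eta.
case: f => a b c d e.
move: (c11 0 0) (c11 0 1) (c11 0 2) (c22 0 0) (c22 0 1) (c22 0 2) (c33 0 0) (c33 0 1) (c33 0 2).
move=> p1 p2 p3 q1 q2 q3 r1 r2 r3.
move: (c12 0 0) (c12 0 1) (c12 0 2) (c13 0 0) (c13 0 1) (c13 0 2) (c23 0 0) (c23 0 1) (c23 0 2).
move=> s1 s2 s3 t1 t2 t3 u1 u2 u3 H; rewrite !row3E => hs1 hs2 ht1.
have {}H (x1 x2 x3 y1 y2 y3 z1 z2 z3 : int) :
    z1 = p1 * (x1 * y1) + q1 * (x2 * y2) + r1 * (x3 * y3) + s1 * (x1 * y2 + x2 * y1)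
         + t1 * (x1 * y3 + x3 * y1) + u1 * (x2 * y3 + x3 * y2) ->
    z2 = p2 * (x1 * y1) + q2 * (x2 * y2) + r2 * (x3 * y3) + s2 * (x1 * y2 + x2 * y1)
         + t2 * (x1 * y3 + x3 * y1) + u2 * (x2 * y3 + x3 * y2) ->
    z3 = p3 * (x1 * y1) + q3 * (x2 * y2) + r3 * (x3 * y3) + s3 * (x1 * y2 + x2 * y1)
         + t3 * (x1 * y3 + x3 * y1) + u3 * (x2 * y3 + x3 * y2) ->
    x1 * (y2 * z3 - y3 * z2) - x2 * (y1 * z3 - y3 * z1) + x3 * (y1 * z2 - y2 * z1)
    = (e * x1 ^+ 2 + a * x2 ^+ 2 + c * x3 ^+ 2 + d * (x1 * x3) + b * (x2 * x3)) * (y3 ^+ 2 - y1 * y2)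
      - (x3 ^+ 2 - x1 * x2) * (e * y1 ^+ 2 + a * y2 ^+ 2 + c * y3 ^+ 2 + d * (y1 * y3) + b * (y2 * y3)).
  move=> -> -> ->; have := H (row3 x1 x2 x3) (row3 y1 y2 y3).
  by rewrite /= det_mx33 !mx3E /tqf_eval !row3E /= => h; apply: etrans (etrans _ h) _; ring.
have E x1 x2 x3 y1 y2 y3 := H x1 x2 x3 y1 y2 y3 _ _ _ erefl erefl erefl.
(* Fifteen samples, enough to solve for the fifteen remaining unknowns. *)
have := E 1 0 0 0 1 0; have := E 1 0 0 0 0 1; have := E 0 1 0 0 0 1.
have := E 1 0 0 0 1 1; have := E 0 1 0 1 0 1; have := E 0 0 1 1 1 0.
have := E 1 0 0 1 1 0; have := E 1 0 0 1 0 1; have := E 0 1 0 1 1 0.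
have := E 0 1 0 0 1 1; have := E 0 0 1 1 0 1; have := E 0 0 1 0 1 1.
have := E 1 1 0 0 1 1; have := E 1 1 0 1 0 1; have := E 1 0 1 0 1 1.
clear H E; subst s1 s2 t1; move=> *.
have row30 : row3 0 0 0 = 0 by apply/rowP => [[[|[|[|i]]] //= hi]]; rewrite !mxE.
by split; split; rewrite -?row30; congr row3; rewrite /=; lia.
Qed.

Section Recognition.
Variables (Q C : comNzRingType) (phi : modZ Q -> modZ C).
Variable delta : {additive extpow 4 Q -> extpow 3 C}.
Hypotheses (nicQ : nic_ring 4 Q) (nicC : nic_ring 3 C).
Hypothesis delta_phi : forall x y : Q, delta (wedge [tuple 1; x; y; x * y])
  = wedge1 [tuple phi (\pi_(modZ Q) x); phi (\pi_(modZ Q) y)].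
Variables (alpha : 3.-tuple (modZ Q)) (om th : modZ C) (f : bqf).
Hypothesis had : adapted phi delta alpha om th form_A0 (form_B f) (resolvent_bcf f).

(** The table of [R_f], for the lifts a1, a2, a3 of the basis alpha that stand
    for zeta3', zeta1, zeta2. *)
Definition qr_table (a1 a2 a3 : Q) : Prop :=
  [/\ a2 * a2 = - (a2 *~ f1 f) + a3 *~ f0 f,
      a2 * a3 = - (a2 *~ f2 f) + a1 *~ f0 f - (f0 f * f3 f)%:~R
    & a2 * a1 = - (f0 f * f4 f)%:~R] /\
  [/\ a3 * a3 = - (a2 *~ f3 f) - a3 *~ f2 f + a1 *~ f1 f
                - (f1 f * f3 f)%:~R - (f0 f * f4 f)%:~R,
      a3 * a1 = - (a2 *~ f4 f) - (f1 f * f4 f)%:~R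
    & a1 * a1 = - (a3 *~ f4 f) + a1 *~ f3 f - (f2 f * f4 f)%:~R].

Section Constants.
Variables a1 a2 a3 : Q.
Hypothesis ha : zbasis [tuple 1; a1; a2; a3].
Let lin k x y z := k%:~R + a1 *~ x + a2 *~ y + a3 *~ z.

Lemma lin_inj k x y z k' x' y' z' : lin k x y z = lin k' x' y' z' ->
  [/\ k = k', x = x', y = y' & z = z'].
Proof.
have [co [coK _]] := zbasis_co ha.
have E l u v w : lin l u v w = zlincomb [tuple 1; a1; a2; a3] (\row_j [:: l; u; v; w]`_j).
  by rewrite /lin /zlincomb !big_ord_recl big_ord0 !mxE addr0 !addrA !(tnth_nth 0).
rewrite !E => /(congr1 co); rewrite !coK => /rowP h.
have := h ord0; have := h (lift ord0 ord0); have := h (lift ord0 (lift ord0 ord0)).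
by have := h (lift ord0 (lift ord0 (lift ord0 ord0))); rewrite !mxE /= => -> -> -> ->.
Qed.

(** Associativity determines the constant terms of the table. *)
Lemma table_constants k11 k22 k33 k12 k13 k23 :
  a1 * a1 = lin k11 (f3 f) 0 (- f4 f) -> a2 * a2 = lin k22 0 (- f1 f) (f0 f) ->
  a3 * a3 = lin k33 (f1 f) (- f3 f) (- f2 f) -> a1 * a2 = lin k12 0 0 0 ->
  a1 * a3 = lin k13 0 (- f4 f) 0 -> a2 * a3 = lin k23 (f0 f) (- f2 f) 0 ->
  qr_table a1 a2 a3.
Proof.
move=> h11 h22 h33 h12 h13 h23.
have linM1 k x y z : a1 * lin k x y z = a1 *~ k + (a1 * a1) *~ x + (a1 * a2) *~ y + (a1 * a3) *~ z.
  by rewrite /lin; ring.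
have linM2 k x y z : a2 * lin k x y z = a2 *~ k + (a1 * a2) *~ x + (a2 * a2) *~ y + (a2 * a3) *~ z.
  by rewrite /lin; ring.
have linM3 k x y z : a3 * lin k x y z = a3 *~ k + (a1 * a3) *~ x + (a2 * a3) *~ y + (a3 * a3) *~ z.
  by rewrite /lin; ring.
have [_ e22 e12 _] : [/\ f0 f * k13 - f1 f * k12 = 0, k22 = 0, - (f0 f * f4 f) = k12 & 0 = 0 :> int].
  apply: lin_inj; transitivity (a1 * (a2 * a2)).
    by rewrite h22 linM1 h12 h13 /lin; ring.
  by rewrite mulrCA h12 linM2 /lin; ring.
have [_ _ e11 _] : [/\ f3 f * k12 - f4 f * k23 = 0, - (f4 f * f0 f) = k12,
   k11 + f2 f * f4 f = 0 & 0 = 0 :> int].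
  apply: lin_inj; transitivity (a2 * (a1 * a1)).
    by rewrite h11 linM2 h12 h23 /lin; ring.
  by rewrite mulrCA [a2 * a1]mulrC h12 linM1 /lin; ring.
have [_ e33 _ e13] : [/\ f1 f * k11 - f3 f * k12 - f2 f * k13 = - f4 f * k23,
   k33 + f1 f * f3 f = - (f4 f * f0 f), f2 f * f4 f = f4 f * f2 f & - (f1 f * f4 f) = k13].
  apply: lin_inj; transitivity (a1 * (a3 * a3)).
    by rewrite h33 linM1 h11 h12 h13 /lin; ring.
  by rewrite mulrCA h13 linM3 h23 /lin; ring.
have [_ _ e23 _] : [/\ f0 f * k12 - f2 f * k22 = - f1 f * k23 + f0 f * k33,
   0 = - f1 f * f0 f + f0 f * f1 f,
   k23 + f2 f * f1 f  = f1 f * f2 f - f0 f * f3 f & - (f2 f * f0 f) = k22 - f0 f * f2 f].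
  apply: lin_inj; transitivity (a2 * (a2 * a3)).
    by rewrite h23 linM2 h12 h22 /lin; ring.
  by rewrite mulrA h22 mulrC linM3 h13 h23 h33 /lin; ring.
have {}e23 : k23 = - (f0 f * f3 f) by lia.
have {}e33 : k33 = - (f1 f * f3 f) - f0 f * f4 f by lia.
have {}e11 : k11 = - (f2 f * f4 f) by lia.
rewrite /qr_table ![_ * a1]mulrC h11 h22 h33 h12 h13 h23 -e12 -e13 e22 e11 e33 e23 /lin.
by split; split; ring.
Qed.

End Constants.

(** Shifting the lifts by integers changes c12 by multiples of the first two
    basis vectors and c13_1 by an integer, which achieves the normalization. *)
Lemma normalized_lifts : exists a1 a2 a3 : Q,
  alpha = [tuple \pi_(modZ Q) a1; \pi_(modZ Q) a2; \pi_(modZ Q) a3] /\ qr_table a1 a2 a3.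
Proof.
have [co [coK eK]] := zbasis_co (ad_alpha had).
pose b i : Q := repr (tnth alpha i).
have pib i : \pi_(modZ Q) (b i) = tnth alpha i by rewrite reprK.
pose c0 i j := co (\pi_(modZ Q) (b i * b j)).
pose a1 := b 0 - (c0 0 1 0 1)%:~R; pose a2 := b 1 - (c0 0 1 0 0)%:~R.
pose a3 := b 2 - (c0 0 2 0 0)%:~R.
have pia i n : \pi_(modZ Q) (b i - n%:~R) = tnth alpha i.
  by rewrite -pib; apply: (modZ_eq (n := - n)); rewrite rmorphN.
have alphaE : alpha = [tuple \pi_(modZ Q) a1; \pi_(modZ Q) a2; \pi_(modZ Q) a3].
  apply: eq_from_tnth => -[[|[|[|i]]] //= hi]; rewrite [RHS](tnth_nth 0) /= /a1 /a2 /a3 pia;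
    by congr (tnth alpha _); apply: val_inj.
exists a1, a2, a3; split=> //.
have ab : zbasis [tuple 1; a1; a2; a3].
  have -> : [tuple 1; a1; a2; a3] = [tuple of 1 :: [tuple a1; a2; a3]] by apply: val_inj.
  apply: (zbasis_lift nicQ); congr zbasis: (ad_alpha had).
  by rewrite alphaE; apply: val_inj.
have cshift i j m n : co (\pi_(modZ Q) ((b i - m%:~R) * (b j - n%:~R)))
    = c0 i j - delta_mx 0 i *~ n - delta_mx 0 j *~ m.
  have -> : (b i - m%:~R) * (b j - n%:~R) = b i * b j - b i *~ n - b j *~ m + (m * n)%:~R by ring.
  rewrite (modZ_eq (n := m * n) erefl) !raddfB !raddfMz /= !pib.
  by rewrite -!(zlincomb_delta alpha) !coK.
have lc (W : 'rV[int]_3) : \pi_(modZ Q) (a1 *~ W 0 0 + a2 *~ W 0 1 + a3 *~ W 0 2) = zlincomb alpha W.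
  by rewrite alphaE zlincomb3 -!raddfMz -!raddfD.
pose c (x y : Q) : 'rV[int]_3 := co (\pi_(modZ Q) (x * y)).
have [] := @structure_constants f (c a1 a1) (c a2 a2) (c a3 a3) (c a1 a2) (c a1 a3) (c a2 a3).
- move=> X Y Z.
  pose x := a1 *~ X 0 0 + a2 *~ X 0 1 + a3 *~ X 0 2.
  pose y := a1 *~ Y 0 0 + a2 *~ Y 0 1 + a3 *~ Y 0 2.
  have := @adapted_structure _ _ _ _ nicQ nicC delta_phi _ _ _ _ _ _ had x y X Y
    (row3 (Z 0) (Z 1) (Z 2)) (lc X) (lc Y).
  rewrite !row3E; apply.
  have -> : x * y = (a1 * a1) *~ (X 0 0 * Y 0 0) + (a2 * a2) *~ (X 0 1 * Y 0 1) + (a3 * a3) *~ (X 0 2 * Y 0 2)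
     + (a1 * a2) *~ (X 0 0 * Y 0 1 + X 0 1 * Y 0 0) + (a1 * a3) *~ (X 0 0 * Y 0 2 + X 0 2 * Y 0 0)
     + (a2 * a3) *~ (X 0 1 * Y 0 2 + X 0 2 * Y 0 1) by rewrite /x /y; ring.
  rewrite -[LHS]eK; congr (zlincomb _ _); rewrite !raddfD !raddfMz /= -!/(c _ _).
  by rewrite [LHS]row3_eta -!scaler_int !mxE !intz; congr row3; rewrite /Z; ring.
- by rewrite /c /a1 /a2 cshift -!scaler_int !mxE /= !intz; ring.
- by rewrite /c /a1 /a2 cshift -!scaler_int !mxE /= !intz; ring.
- by rewrite /c /a1 /a3 cshift -!scaler_int !mxE /= !intz; ring.
have clin x y : exists k : int,
    x * y = k%:~R + a1 *~ c x y 0 0 + a2 *~ c x y 0 1 + a3 *~ c x y 0 2.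
  have : \pi_(modZ Q) (x * y) = \pi_(modZ Q) (a1 *~ c x y 0 0 + a2 *~ c x y 0 1 + a3 *~ c x y 0 2).
    by rewrite lc /c eK.
  by case/modZ_eqP => k hk; exists k; rewrite hk; ring.
move=> [e11 e22 e33] [e12 e13 e23].
have [k11 h11] := clin a1 a1; have [k22 h22] := clin a2 a2; have [k33 h33] := clin a3 a3.
have [k12 h12] := clin a1 a2; have [k13 h13] := clin a1 a3; have [k23 h23] := clin a2 a3.
move: h11 h22 h33 h12 h13 h23; rewrite e11 e22 e33 e12 e13 e23 !row3E !mxE.
exact: table_constants.
Qed.

Section Isomorphism.
Variables a1 a2 a3 : Q.
Hypothesis alphaE : alpha = [tuple \pi_(modZ Q) a1; \pi_(modZ Q) a2; \pi_(modZ Q) a3].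
Hypothesis table : qr_table a1 a2 a3.

Definition qr_map (x : quartic_ring f) : Q :=
  x.1.1.1%:~R + a2 *~ x.1.1.2 + a3 *~ x.1.2 + a1 *~ x.2.

Lemma qr_mapB : {morph qr_map : x y / x - y}.
Proof. by move=> [[[x0 x1] x2] x3] [[[y0 y1] y2] y3]; rewrite /qr_map /=; ring. Qed.

Lemma qr_mapM : monoid_morphism qr_map.
Proof.
split=> [|[[[x0 x1] x2] x3] [[[y0 y1] y2] y3]]; first by rewrite /qr_map /=; ring.
have [[h22 h23 h21] [h33 h31 h11]] := table.
transitivity (x0%:~R * y0%:~R + a2 *~ (x0 * y1 + x1 * y0) + a3 *~ (x0 * y2 + x2 * y0)
  + a1 *~ (x0 * y3 + x3 * y0) + (a2 * a2) *~ (x1 * y1) + (a3 * a3) *~ (x2 * y2)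
  + (a1 * a1) *~ (x3 * y3) + (a2 * a3) *~ (x1 * y2 + x2 * y1)
  + (a2 * a1) *~ (x1 * y3 + x3 * y1) + (a3 * a1) *~ (x2 * y3 + x3 * y2)); last first.
  by rewrite /qr_map /=; ring.
by rewrite h22 h23 h21 h33 h31 h11 /qr_map /=; ring.
Qed.

HB.instance Definition _ := GRing.isZmodMorphism.Build _ _ qr_map qr_mapB.
HB.instance Definition _ := GRing.isMonoidMorphism.Build _ _ qr_map qr_mapM.

Lemma qr_map_bij : bijective qr_map.
Proof.
have [co [coK eK]] : exists co : {additive Q -> 'rV[int]_4},
   cancel (zlincomb [tuple 1; a1; a2; a3]) co /\ cancel co (zlincomb [tuple 1; a1; a2; a3]).
  apply: zbasis_co; have -> : [tuple 1; a1; a2; a3] = [tuple of 1 :: [tuple a1; a2; a3]] by apply: val_inj.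
  apply: (zbasis_lift nicQ); congr zbasis: (ad_alpha had).
  by rewrite alphaE; apply: val_inj.
have E (r : quartic_ring f) : qr_map r = zlincomb [tuple 1; a1; a2; a3] (qr_co r).
  case: r => [[[x0 x1] x2] x3].
  rewrite /qr_map /zlincomb !big_ord_recl big_ord0 !mxE addr0 !(tnth_nth 0) /=; ring.
exists (fun x => (co x 0 0, co x 0 2, co x 0 3, co x 0 1) : quartic_ring f) => [r|x].
  by rewrite E coK; case: r => [[[x0 x1] x2] x3]; rewrite !mxE.
rewrite E -[RHS]eK; congr (zlincomb _ _).
by apply/rowP => [[[|[|[|[|i]]]] //= hi]]; rewrite !mxE /=; congr (co x _ _); apply: val_inj.
Qed.

Lemma qr_map_iso :
  exists2 h : {rmorphism quartic_ring f -> Q}, bijective h & h =1 qr_map.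
Proof. by exists qr_map; first exact: qr_map_bij. Qed.

End Isomorphism.

Section CubicIsomorphism.
Variables w t : C.
Hypothesis hw : \pi_(modZ C) w = om.
Hypothesis ht : \pi_(modZ C) t = th.
Let g := resolvent_bcf f.
Hypothesis wt : w * t = (- (ca g * cd g))%:~R.
Hypothesis ww : w ^+ 2 = (- (ca g * cc g))%:~R + w *~ cb g - t *~ ca g.
Hypothesis tt : t ^+ 2 = (- (cb g * cd g))%:~R + w *~ cd g - t *~ cc g.

Definition cr_map (x : cubic_ring g) : C := x.1.1%:~R + w *~ x.1.2 + t *~ x.2.

Lemma cr_mapB : {morph cr_map : x y / x - y}.
Proof. by move=> [[x0 x1] x2] [[y0 y1] y2]; rewrite /cr_map /=; ring. Qed.

Lemma cr_mapM : monoid_morphism cr_map.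
Proof.
split=> [|[[x0 x1] x2] [[y0 y1] y2]]; first by rewrite /cr_map /=; ring.
transitivity (x0%:~R * y0%:~R + w *~ (x0 * y1 + x1 * y0) + t *~ (x0 * y2 + x2 * y0)
  + w ^+ 2 *~ (x1 * y1) + t ^+ 2 *~ (x2 * y2) + (w * t) *~ (x1 * y2 + x2 * y1)); last first.
  by rewrite /cr_map; cbn [fst snd]; ring.
rewrite wt ww tt /cr_map; move: g => [a b c d] /=; ring.
Qed.

HB.instance Definition _ := GRing.isZmodMorphism.Build _ _ cr_map cr_mapB.
HB.instance Definition _ := GRing.isMonoidMorphism.Build _ _ cr_map cr_mapM.

Lemma cr_map_bij : bijective cr_map.
Proof.
have [co [coK eK]] : exists co : {additive C -> 'rV[int]_3},
   cancel (zlincomb [tuple 1; w; t]) co /\ cancel co (zlincomb [tuple 1; w; t]).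
  apply: zbasis_co; have -> : [tuple 1; w; t] = [tuple of 1 :: [tuple w; t]] by apply: val_inj.
  apply: (zbasis_lift nicC); congr zbasis: (ad_omega had).
  by apply: val_inj; rewrite /= hw ht.
have E (r : cubic_ring g) : cr_map r = zlincomb [tuple 1; w; t] (cr_co (f := f) r).
  case: r => [[x0 x1] x2].
  rewrite /cr_map /zlincomb !big_ord_recl big_ord0 !mxE addr0 !(tnth_nth 0) /=; ring.
exists (fun x => (co x 0 0, co x 0 1, co x 0 2) : cubic_ring g) => [r|x].
  by rewrite E coK; case: r => [[x0 x1] x2]; rewrite !mxE.
rewrite E -[RHS]eK; congr (zlincomb _ _).
by apply/rowP => [[[|[|[|i]]] //= hi]]; rewrite !mxE /=; congr (co x _ _); apply: val_inj.
Qed.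

Lemma cr_map_iso : exists2 k : {rmorphism cubic_ring g -> C}, bijective k &
  modZ_map k (cr_omega g) = om /\ modZ_map k (cr_theta g) = th.
Proof.
exists cr_map; first exact: cr_map_bij.
by rewrite !modZ_map_pi -hw -ht; split; congr (\pi_(modZ C) _); rewrite /= /cr_map /=; ring.
Qed.

End CubicIsomorphism.

(** An adapted basis in normal form identifies the pair with the pair of f. *)
Lemma adapted_iso : exists (h : {rmorphism quartic_ring f -> Q})
    (k : {rmorphism cubic_ring (resolvent_bcf f) -> C}),
  [/\ bijective h, bijective k,
      forall x, modZ_map k (qr_phi x) = phi (modZ_map h x)
    & modZ_map k (cr_omega (resolvent_bcf f)) = om].
Proof.
have [a1 [a2 [a3 [alphaE table]]]] := normalized_lifts.
have [w [t [hw ht wt ww tt]]] := ad_form had.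
have [h hb hE] := qr_map_iso alphaE table.
have [k kb [kom kth]] := cr_map_iso hw ht wt ww tt.
exists h, k; split=> // x; have [c _ cK] := qr_alpha_zbasis f.
rewrite -(cK x) /qr_phi qr_tK raddfD !raddfMz /= kom kth -(ad_phi had); congr phi.
rewrite -zlincomb_map; congr (zlincomb _ _); rewrite alphaE.
by apply: val_inj; rewrite /= !modZ_map_pi !hE /qr_map /=;
  congr [:: _; _; _]; congr (\pi_(modZ Q) _); ring.
Qed.

End Recognition.

Lemma mp_iso_normal_form (P : monogenized_pair) f alpha th :
  adapted (res_phi (mp_res P)) (res_delta (mp_res P)) alpha (mp_gen P) th
    form_A0 (form_B f) (resolvent_bcf f) ->
  mp_iso (pair_of_form f) P.
Proof.
exact: (adapted_iso (mp_quarticP P) (res_cubic (mp_res P)) (@res_delta_phi _ (mp_res P))).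
Qed.

Lemma pair_of_form_surj (P : monogenized_pair) : exists f, mp_iso (pair_of_form f) P.
Proof.
have [f [al [th had]]] := adapted_normal_form (mp_quarticP P) (res_cubic (mp_res P))
  (res_form (mp_res P)) (@mp_genP P).
by exists f; apply: mp_iso_normal_form had.
Qed.

(** * Equivalence of forms and isomorphism of pairs *)

Lemma sqr1_int (x : int) : x ^+ 2 = 1 -> x \is a GRing.unit.
Proof. by move=> h; apply/unitrP; exists x; rewrite -expr2. Qed.

Lemma unit_sqr1 (x : int) : x \is a GRing.unit -> x ^+ 2 = 1.
Proof. by case/unitrP=> y [/intUnitRing.unitzPl + _]; rewrite unfold_in => /orP[] /eqP ->. Qed.

(** The action of GL_2(Z) on forms only has to be tested on integral points. *)
Lemma gl2_equivP f g : gl2_equiv f g <-> exists a b c d : int,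
  (a * d - b * c) ^+ 2 = 1 /\
  forall x y : int, bqf_eval g x y = bqf_eval f (a * x + c * y) (b * x + d * y).
Proof.
split=> [[m um h]|[a [b [c [d [e h]]]]]].
  exists (m 0 0), (m 0 1), (m 1 0), (m 1 1); split=> [|x y].
    by rewrite -det_mx22; apply: unit_sqr1; rewrite -unitmxE.
  pose ev : {rmorphism {poly {poly int}} -> int} :=
    (horner_eval y \o horner_eval (x%:P))%FUN.
  have evX : ev 'X = x by rewrite /ev /= /horner_eval hornerX hornerC.
  have evY : ev ('X)%:P = y by rewrite /ev /= /horner_eval hornerC hornerX.
  move/(congr1 ev): h; rewrite !bqf_eval_rmorph !rmorphD !rmorphM !rmorph_int evX evY.
  by rewrite !intz.
exists (mx2 a b c d); first by rewrite unitmxE det_mx2 sqr1_int.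
(* The coefficients of f (a x + c y, b x + d y). *)
pose q0 := bqf_eval f a b; pose q4 := bqf_eval f c d.
pose q1 := 4 * f0 f * a ^+ 3 * c + f1 f * (a ^+ 3 * d + 3 * a ^+ 2 * b * c)
  + 2 * f2 f * (a * b ^+ 2 * c + a ^+ 2 * b * d)
  + f3 f * (b ^+ 3 * c + 3 * a * b ^+ 2 * d) + 4 * f4 f * b ^+ 3 * d.
pose q3 := 4 * f0 f * c ^+ 3 * a + f1 f * (c ^+ 3 * b + 3 * c ^+ 2 * d * a)
  + 2 * f2 f * (c * d ^+ 2 * a + c ^+ 2 * d * b)
  + f3 f * (d ^+ 3 * a + 3 * c * d ^+ 2 * b) + 4 * f4 f * d ^+ 3 * b.
pose q2 := 6 * f0 f * a ^+ 2 * c ^+ 2 + 3 * f1 f * (a ^+ 2 * c * d + a * b * c ^+ 2)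
  + f2 f * (a ^+ 2 * d ^+ 2 + 4 * a * b * c * d + b ^+ 2 * c ^+ 2)
  + 3 * f3 f * (b ^+ 2 * c * d + a * b * d ^+ 2) + 6 * f4 f * b ^+ 2 * d ^+ 2.
have -> : g = BQF q0 q1 q2 q3 q4.
  apply: bqf_ext => x y; rewrite h /q0 /q1 /q2 /q3 /q4 /bqf_eval /= !intz; ring.
rewrite /q0 /q1 /q2 /q3 /q4 !mxE /= /bqf_eval /= !intz; ring.
Qed.

Lemma gl2_equiv_refl f : gl2_equiv f f.
Proof. by apply/gl2_equivP; exists 1, 0, 0, 1; split=> [//|x y]; congr bqf_eval; ring. Qed.

Lemma gl2_equiv_sym f g : gl2_equiv f g -> gl2_equiv g f.
Proof.
move=> /gl2_equivP[a [b [c [d [e h]]]]]; apply/gl2_equivP.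
set v := a * d - b * c in e.
exists (v * d), (- v * b), (- v * c), (v * a); split=> [|x y].
  by rewrite (_ : _ - _ = v ^+ 2 * v); [rewrite e mul1r e | rewrite /v; ring].
by rewrite h; congr bqf_eval; rewrite -[LHS]mul1r -e /v; ring.
Qed.

Lemma gl2_equiv_trans f g k : gl2_equiv f g -> gl2_equiv g k -> gl2_equiv f k.
Proof.
move=> /gl2_equivP[a [b [c [d [e h]]]]] /gl2_equivP[a' [b' [c' [d' [e' h']]]]].
apply/gl2_equivP.
exists (a * a' + c * b'), (b * a' + d * b'), (a * c' + c * d'), (b * c' + d * d').
split=> [|x y]; first by rewrite -[RHS]mul1r -{1}e -e'; ring.
by rewrite h' h; congr bqf_eval; ring.
Qed.

Lemma rmorph_inv (R S : comNzRingType) (h : {rmorphism R -> S}) : bijective h ->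
  exists h' : {rmorphism S -> R}, cancel h h' /\ cancel h' h.
Proof.
move=> hb; have [h' hK h'K] := hb; have hI := bij_inj hb.
have hB : {morph h' : x y / x - y} by move=> x y; apply: hI; rewrite rmorphB !h'K.
have hM : monoid_morphism h'.
  by split=> [|x y]; apply: hI; rewrite ?rmorphM ?rmorph1 !h'K.
by exists (HB.pack_for {rmorphism S -> R} h' (GRing.isZmodMorphism.Build _ _ h' hB)
  (GRing.isMonoidMorphism.Build _ _ h' hM)).
Qed.

Lemma modZ_map_id (R : comNzRingType) (x : modZ R) : modZ_map idfun x = x.
Proof. exact: reprK. Qed.

Lemma modZ_map_comp (R S T : comNzRingType) (h : {rmorphism R -> S}) (k : {rmorphism S -> T}) x :
  modZ_map (k \o h) x = modZ_map k (modZ_map h x).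
Proof.
rewrite -(reprK x) (modZ_map_pi h) (modZ_map_pi k).
exact: (modZ_map_pi (k \o h)).
Qed.

Lemma eq_modZ_map (R S : comNzRingType) (h k : R -> S) : h =1 k -> modZ_map h =1 modZ_map k.
Proof. by move=> e x; rewrite /modZ_map e. Qed.

Lemma mp_iso_refl P : mp_iso P P.
Proof.
exists idfun, idfun; split; try (by exists idfun); last exact: modZ_map_id.
by move=> x; apply: etrans (modZ_map_id _) _; rewrite [modZ_map _ x]modZ_map_id.
Qed.

Lemma mp_iso_sym P P' : mp_iso P P' -> mp_iso P' P.
Proof.
move=> [h [k [hb kb hk homega]]].
have [h' [hK h'K]] := rmorph_inv hb; have [k' [kK k'K]] := rmorph_inv kb.
exists h', k'; split; [by exists h | by exists k | | ].
  move=> x; rewrite -{1}(modZ_map_id x) -(eq_modZ_map (h'K : h \o h' =1 idfun)) modZ_map_comp -hk.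
  by rewrite -modZ_map_comp (eq_modZ_map (kK : k' \o k =1 idfun)) modZ_map_id.
by rewrite -homega -modZ_map_comp (eq_modZ_map (kK : k' \o k =1 idfun)) modZ_map_id.
Qed.

Lemma mp_iso_trans P P' P'' : mp_iso P P' -> mp_iso P' P'' -> mp_iso P P''.
Proof.
move=> [h [k [hb kb hk homega]]] [h' [k' [hb' kb' hk' homega']]].
exists (h' \o h), (k' \o k); split; [exact: bij_comp | exact: bij_comp | | ].
  by move=> x; rewrite !modZ_map_comp hk hk'.
by rewrite modZ_map_comp homega homega'.
Qed.

Lemma adapted_pair_of_form f :
  adapted (@qr_phi f) (@qr_delta f) (qr_alpha f) (cr_omega (resolvent_bcf f)) (cr_theta _)
    form_A0 (form_B f) (resolvent_bcf f).
Proof.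
split; [exact: qr_alpha_zbasis | exact: cr_zbasis | exact: qr_delta_alpha |
  | exact: det_form_resolvent | exact: cubic_ring_form].
by move=> t; rewrite /qr_phi qr_tK.
Qed.

(** A substitution acts on the conic through the matrix [N] of Sym^2, which
    preserves A0; changing alpha by [N] (up to the sign that makes its
    determinant 1) turns B_g into a form restricting to f on the conic. *)
Lemma gl2_equiv_mp_iso f g : gl2_equiv f g -> mp_iso (pair_of_form f) (pair_of_form g).
Proof.
move/gl2_equiv_sym/gl2_equivP => [a [b [c [d [e h]]]]].
pose v := a * d - b * c.
pose N : 'M[int]_3 := mx3 0 [:: [:: v * d ^+ 2; v * c ^+ 2; v * (c * d)];
  [:: v * b ^+ 2; v * a ^+ 2; v * (a * b)];
  [:: v * (2 * b * d); v * (2 * a * c); v * (a * d + b * c)]].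
have dN : \det N = 1.
  transitivity ((v ^+ 2) ^+ 3); last by rewrite /v e.
  by rewrite det_mx33 !mx3E /v; ring.
have had := adapted_change (qr_nic g) (cr_nic g) (N := N) (p := 1) (q := 0) (r := 0) (s := 1)
  (adapted_pair_of_form g) dN ltac:(by ring) ltac:(by []).
rewrite !mulr1z !mulr0z addr0 add0r in had.
have A3 : tqf_pull N (tqf_comb (1 * 1) form_A0 (- (1 * 0)) (form_B g)) = form_A0.
  apply: tqf_ext => t; rewrite tqf_pullE tqf_combE mulmx_row3 !mx3E !form_A0E.
  rewrite [in RHS](row3_eta t) form_A0E; set q := t 0 2 ^+ 2 - _.
  by transitivity ((v ^+ 2) ^+ 2 * q); [rewrite /v /q; ring | rewrite /v e; ring].
rewrite A3 in had.
have [f' [al [th [had' hf']]]] := adapted_form_B (qr_nic g) (cr_nic g) had.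
suff ff : f' = f by rewrite -ff; apply: (@mp_iso_normal_form (pair_of_form g)) had'.
apply: bqf_ext => x y; rewrite hf' h -form_B_conic tqf_pullE tqf_combE.
have -> : conic x y *m N = v *: conic (a * x + c * y) (b * x + d * y).
  rewrite mulmx_row3 !mx3E [RHS]row3_eta.
  by congr row3; rewrite /conic !mxE /=; ring.
set w := conic _ _; transitivity (v ^+ 2 * tqf_eval (form_B g) w); last by rewrite /v e mul1r.
by rewrite /tqf_eval !mxE; ring.
Qed.

(** The isomorphism sends theta to u omega + s theta, and comparing Det A0 forces
    s = 1; so it induces an isometry of A0, which acts on the conic through a
    substitution. *)
Lemma mp_iso_gl2_equiv f g : mp_iso (pair_of_form f) (pair_of_form g) -> gl2_equiv f g.
Proof.
move=> [h [k [hb kb hk hom]]]; apply: gl2_equiv_sym; apply/gl2_equivP.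
move: h k hb kb hk hom; rewrite /mp_cubic /=.
move=> h k hb kb hk hom.
pose M : 'M[int]_3 := \matrix_i qr_t (modZ_map h (tnth (qr_alpha f) i)).
have hM t : modZ_map h (zlincomb (qr_alpha f) t) = zlincomb (qr_alpha g) (t *m M).
  have [co coK eK] := qr_alpha_zbasis g.
  have {}eK x : zlincomb (qr_alpha g) (qr_t x) = x by rewrite -{1}(eK x) qr_tK eK.
  rewrite -[LHS]eK; congr zlincomb; rewrite mulmx_sum_row /zlincomb !raddf_sum /=.
  by apply: eq_bigr => i _; rewrite !raddfMz /= rowK -[t 0 i in RHS]intz scaler_int.
have [co [coK eK]] := zbasis_co (cr_zbasis g).
have [u [s us]] : exists u s, modZ_map k (cr_theta (resolvent_bcf f))
    = cr_omega (resolvent_bcf g) *~ u + cr_theta _ *~ s.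
  set z := modZ_map k _.
  by exists (co z 0 0), (co z 0 1); rewrite -zlincomb2 eK.
have hAB t : tqf_eval (form_B g) (t *m M) = tqf_eval (form_B f) t + u * tqf_eval form_A0 t
    /\ tqf_eval form_A0 (t *m M) = s * tqf_eval form_A0 t.
  have := hk (zlincomb (qr_alpha f) t).
  rewrite hM /qr_phi /= !qr_tK raddfD !raddfMz /= hom us.
  move: (tqf_eval (form_B g) _) (tqf_eval form_A0 (t *m M)) (tqf_eval (form_B f) t) (tqf_eval form_A0 t).
  move=> b2 a2 b1 a1 E.
  have {}E : zlincomb [tuple cr_omega (resolvent_bcf g); cr_theta (resolvent_bcf g)]
     (\row_j [:: b1 + u * a1; s * a1]`_j)
    = zlincomb [tuple cr_omega (resolvent_bcf g); cr_theta (resolvent_bcf g)] (\row_j [:: b2; a2]`_j).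
    by rewrite !zlincomb2 !mxE /= -E mulrzDl mulrzDr -!mulrzA addrA.
  move/(congr1 co): E; rewrite !coK => /rowP E.
  by have := E 0; have := E 1; rewrite !mxE.
have M1 : (\det M) ^+ 2 = 1.
  have [h' hK h'K] := hb; pose z i : quartic_ring g := repr (tnth (qr_alpha g) i).
  pose N : 'M[int]_3 := \matrix_i qr_t (\pi_(modZ (quartic_ring f)) (h' (z i))).
  suff NM : N *m M = 1%:M.
    by apply/unit_sqr1/unitrP; exists (\det N); rewrite [\det M * _]mulrC -det_mulmx NM det1.
  have [c cK Kc] := qr_alpha_zbasis f.
  have {}Kc x : zlincomb (qr_alpha f) (qr_t x) = x by rewrite -{1}(Kc x) qr_tK Kc.
  apply/row_matrixP => i; rewrite row_mul rowK row1 -[LHS](@qr_tK g) -hM Kc.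
  by rewrite modZ_map_pi h'K /z reprK -zlincomb_delta qr_tK.
have s1 : s = 1.
  have : tqf_gram (tqf_comb s form_A0 0 form_A0) = M *m tqf_gram form_A0 *m M^T.
    by apply: tqf_gram_pull => t; rewrite tqf_combE mul0r addr0 (hAB t).2.
  rewrite tqf_gram_comb scale0r addr0 => /(congr1 determinant).
  rewrite detZ !det_mulmx det_tr => E.
  have {}E : s ^+ 3 = 1.
    apply: (@mulIf int (\det (tqf_gram form_A0))); first by rewrite det_tqf_gram.
    by rewrite E -M1; ring.
  have : (s %| 1%R)%Z by apply/dvdzP; exists (s ^+ 2); rewrite -E; ring.
  move=> h1; move: (h1 : (s %| 1)%Z); rewrite dvdz1 => /eqP h2.
  have [//|sN] : s = 1 \/ s = -1 by lia.
  by move: E; rewrite sN.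
have [|a [b [c [d [v [e v1 hv]]]]]] := form_A0_isometry M1.
  by move=> t; rewrite (hAB t).2 s1 mul1r.
exists a, b, c, d; split=> // x y.
rewrite -!form_B_conic; have := (hAB (conic x y)).1; rewrite form_A0_conic mulr0 addr0 => <-.
rewrite hv; set w := conic _ _; rewrite -[RHS]mul1r -v1.
by rewrite /tqf_eval !mxE; ring.
Qed.

(** * Discriminants *)

Section Discriminant.
Variables (n : nat) (R S : comNzRingType) (h : {rmorphism R -> S}).
Hypothesis hb : bijective h.
Variables (e : n.-tuple R) (e' : n.-tuple S).
Hypotheses (eb : zbasis e) (eb' : zbasis e').

Lemma zcoordE (T : comNzRingType) (u : n.-tuple T) x : zbasis u -> zlincomb u (zcoord u x) = x.
Proof. by move=> ub; have [c _ Kc] := ub; rewrite -(Kc x) zcoordK. Qed.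

(* The matrix of h in the bases e and e'. *)
Let P : 'M[int]_n := \matrix_i zcoord e' (h (tnth e i)).

Lemma zlincomb_morph c : h (zlincomb e c) = zlincomb e' (c *m P).
Proof.
rewrite raddf_sum mulmx_sum_row raddf_sum; apply: eq_bigr => i _.
by rewrite rowK -[c 0 i in RHS]intz scaler_int !raddfMz /= zcoordE.
Qed.

Lemma zcoord_morph x : zcoord e' (h x) = zcoord e x *m P.
Proof. by rewrite -{1}(zcoordE x eb) zlincomb_morph zcoordK. Qed.

Lemma transition_unit : P \in unitmx.
Proof.
have [h' hK h'K] := hb.
pose N : 'M[int]_n := \matrix_i zcoord e (h' (tnth e' i)).
apply: (@mulmx1_unit _ _ N P _).2; apply/row_matrixP => i.
by rewrite row_mul rowK -zcoord_morph h'K -zlincomb_delta zcoordK // row1.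
Qed.

Lemma mul_trace_morph r : mul_trace e r = mul_trace e' (h r).
Proof.
rewrite /mul_trace; set A := \matrix_(i, j) _; set A' := \matrix_(i, j) _.
suff : A *m P = P *m A'.
  move=> E; rewrite -[A](mulmxK transition_unit) E mxtrace_mulC mulmxA.
  by rewrite (mulVmx transition_unit) mul1mx.
apply/row_matrixP => i; rewrite !row_mul !rowK -zcoord_morph rmorphM.
apply: (bij_inj eb'); rewrite zcoordE // -[X in _ * X](zcoordE _ eb').
move: (zcoord e' _) => c; rewrite mulmx_sum_row raddf_sum /zlincomb mulr_sumr.
apply: eq_bigr => j _; rewrite -[c 0 j in RHS]intz scaler_int raddfMz /= mulrzAr; congr (_ *~ _).
by rewrite rowK -[RHS]/(zlincomb e' _) zcoordE.
Qed.

Lemma mul_traceB : {morph mul_trace e' : x y / x - y}.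
Proof.
move=> x y; rewrite /mul_trace -raddfB; congr (\tr _); apply/matrixP => i j; rewrite !mxE mulrBl.
have [co [coK eK]] := zbasis_co eb'.
have E z : zcoord e' z = co z by rewrite -{1}(eK z) zcoordK.
by rewrite !E raddfB !mxE.
Qed.

(** The Gram matrix of the trace form changes to P G P^T with P unimodular. *)
Lemma basis_disc_morph : basis_disc e = basis_disc e'.
Proof.
pose T : {additive S -> int} := HB.pack_for {additive S -> int} (mul_trace e')
  (GRing.isZmodMorphism.Build _ _ (mul_trace e') mul_traceB).
have TE x : mul_trace e' x = T x by [].
rewrite /basis_disc; set G := \matrix_(i, j) _; set G' := \matrix_(i, j) mul_trace e' _.
have -> : G = P *m G' *m P^T.
  have hE i : h (tnth e i) = \sum_k tnth e' k *~ P i k.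
    rewrite -[LHS](zcoordE _ eb'); apply: eq_bigr => k _; by rewrite mxE.
  apply/matrixP => i j; rewrite [LHS]mxE [RHS]mxE mul_trace_morph rmorphM !hE TE.
  rewrite mulr_sumr raddf_sum; apply: eq_bigr => l _.
  rewrite mulrzAr raddfMz -mulrzr intz; congr (_ * _); last by rewrite [RHS]mxE.
  rewrite mulr_suml raddf_sum [RHS]mxE; apply: eq_bigr => k _.
  by rewrite mulrzAl raddfMz -mulrzr intz mulrC [G' k l]mxE.
have := transition_unit; rewrite unitmxE => /unit_sqr1 P1.
by rewrite !det_mulmx det_tr mulrAC -expr2 P1 mul1r.
Qed.

End Discriminant.

Lemma ring_discE (n : nat) (R S : comNzRingType) (h : {rmorphism R -> S}) (e : n.-tuple R) :
  bijective h -> zbasis e -> ring_disc n S = basis_disc e.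
Proof.
move=> hb eb; rewrite /ring_disc; symmetry; apply: (basis_disc_morph hb eb).
have eb' : zbasis [tuple of map h e].
  have [co coK eK] := eb; have [h' hK h'K] := hb.
  exists (fun x => co (h' x)) => [c|x]; rewrite zlincomb_map; first by rewrite hK coK.
  by rewrite eK; exact: h'K.
by case: xgetP => [u _ //|/(_ _ eb')].
Qed.

Lemma det_mx44 (K : comNzRingType) (x0 : K) (s : seq (seq K)) :
  let a i j := nth x0 (nth [::] s i) j in
  let m j k l := a 1%N j * (a 2%N k * a 3%N l - a 2%N l * a 3%N k)
     - a 1%N k * (a 2%N j * a 3%N l - a 2%N l * a 3%N j)
     + a 1%N l * (a 2%N j * a 3%N k - a 2%N k * a 3%N j) in
  \det (\matrix_(i < 4, j < 4) a i j) =
    a 0%N 0%N * m 1%N 2%N 3%N - a 0%N 1%N * m 0%N 2%N 3%N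
    + a 0%N 2%N * m 0%N 1%N 3%N - a 0%N 3%N * m 0%N 1%N 2%N.
Proof.
move=> a m; rewrite (expand_det_row _ ord0) !big_ord_recl big_ord0 /cofactor !det_mx33 !mxE /=.
rewrite /bump /= !expr0 !expr1 /m; ring.
Qed.

Lemma qr_e_zbasis f : zbasis (qr_e f).
Proof.
exists (@qr_co f) => x; last exact: qr_coK.
apply/rowP => j; rewrite raddf_sum summxE (bigD1 j) //= big1 => [|i ij].
  by rewrite raddfMz -scaler_int mxE qr_co_e eqxx intz mulr1 addr0.
by rewrite raddfMz -scaler_int mxE qr_co_e (negPf ij) mulr0.
Qed.

Lemma cr_e_zbasis f : zbasis (cr_e f).
Proof.
exists (@cr_co f) => x; last exact: cr_coK.
apply/rowP => j; rewrite raddf_sum summxE (bigD1 j) //= big1 => [|i ij].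
  by rewrite raddfMz -scaler_int mxE cr_co_e eqxx intz mulr1 addr0.
by rewrite raddfMz -scaler_int mxE cr_co_e (negPf ij) mulr0.
Qed.

Lemma qr_trace f (r : quartic_ring f) :
  mul_trace (qr_e f) r = 4 * r.1.1.1 - f1 f * r.1.1.2 - 2 * f2 f * r.1.2 + f3 f * r.2.
Proof.
have E x : zcoord (qr_e f) x = qr_co x by rewrite -{1}(qr_coK x) zcoordK //; apply: qr_e_zbasis.
rewrite /mul_trace /mxtrace !big_ord_recl big_ord0 !mxE !E !(tnth_nth 0) /=.
case: r => [[[r0 r1] r2] r3]; rewrite !mxE /=; ring.
Qed.

Lemma cr_trace f (r : cubic_ring (resolvent_bcf f)) :
  mul_trace (cr_e f) r = 3 * r.1.1 + cb (resolvent_bcf f) * r.1.2 - cc (resolvent_bcf f) * r.2.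
Proof.
have E x : zcoord (cr_e f) x = cr_co x by rewrite -{1}(cr_coK x) zcoordK //; apply: cr_e_zbasis.
rewrite /mul_trace /mxtrace !big_ord_recl big_ord0 !mxE !E !(tnth_nth 0) /=.
case: r => [[r0 r1] r2]; rewrite !mxE /=; ring.
Qed.

Lemma qr_disc f : basis_disc (qr_e f) = bqf_disc f.
Proof.
pose a := f0 f; pose b := f1 f; pose c := f2 f; pose d := f3 f; pose e := f4 f.
(* The trace form on 1, zeta3', zeta1, zeta2. *)
pose s : seq (seq int) := [:: [:: 4; d; - b; - 2 * c];
  [:: d; d ^+ 2 - 2 * c * e; - 4 * a * e; - 3 * b * e];
  [:: - b; - 4 * a * e; b ^+ 2 - 2 * a * c; b * c - 3 * a * d];
  [:: - 2 * c; - 3 * b * e; b * c - 3 * a * d; 2 * c ^+ 2 - 2 * b * d - 4 * a * e]].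
rewrite /basis_disc; transitivity (\det (\matrix_(i < 4, j < 4) nth 0 (nth [::] s i) j)).
  congr (\det _); apply/matrixP => [[[|[|[|[|i]]]] //= hi] [[|[|[|[|j]]]] //= hj]];
    rewrite !mxE !(tnth_nth 0) qr_trace /= -/a -/b -/c -/d -/e; ring.
by rewrite det_mx44 /= /bqf_disc -/a -/b -/c -/d -/e; ring.
Qed.

Lemma cr_disc f : basis_disc (cr_e f) = bqf_disc f.
Proof.
pose g := resolvent_bcf f.
rewrite /basis_disc det_mx33 !mxE !cr_trace !(tnth_nth 0) /=.
by rewrite /bqf_disc; ring.
Qed.

(** * The bijection *)

Section Classes.
Variables (T : Type) (r : T -> T -> Prop).
Hypotheses (rR : forall x, r x x) (rS : forall x y, r x y -> r y x).
Hypothesis rT : forall x y z, r x y -> r y z -> r x z.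

Lemma cls_surj (S : classes r) : exists x, S = cls r x.
Proof. by case: S => S [x hx]; exists x; apply: eq_exist. Qed.

Lemma cls_eqP x y : cls r x = cls r y <-> r x y.
Proof.
split=> [/(congr1 (fun S => sval S y)) /= -> //|rxy].
have E : r x = r y.
  by apply/funext => z; apply/propext; split; apply: rT; [apply: rS|].
by apply: eq_exist.
Qed.

End Classes.

Theorem theorem1p1 :
  exists Phi : classes gl2_equiv -> classes mp_iso,
    [/\ bijective Phi,
        forall f : bqf, Phi (cls gl2_equiv f) = cls mp_iso (pair_of_form f),
        forall (f : bqf) (P : monogenized_pair),
          Phi (cls gl2_equiv f) = cls mp_iso P ->
          bqf_disc f = ring_disc 4 (mp_quartic P) /\
          bqf_disc f = ring_disc 3 (mp_cubic P)
      & forall f : bqf,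
          bqf_disc f = ring_disc 4 (quartic_ring f) /\
          bqf_disc f = ring_disc 3 (cubic_ring (resolvent_bcf f))].
Proof.
have gl2P := cls_eqP gl2_equiv_refl gl2_equiv_sym gl2_equiv_trans.
have isoP := cls_eqP mp_iso_refl mp_iso_sym mp_iso_trans.
pose rep (S : classes gl2_equiv) := projT1 (boolp.cid (cls_surj S)).
have repE S : S = cls gl2_equiv (rep S) := projT2 (boolp.cid (cls_surj S)).
pose Phi S := cls mp_iso (pair_of_form (rep S)).
have PhiE f : Phi (cls gl2_equiv f) = cls mp_iso (pair_of_form f).
  by apply/isoP/gl2_equiv_mp_iso/gl2P; rewrite -repE.
have disc f P : Phi (cls gl2_equiv f) = cls mp_iso P ->
    bqf_disc f = ring_disc 4 (mp_quartic P) /\ bqf_disc f = ring_disc 3 (mp_cubic P).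
  rewrite PhiE => /isoP[h [k [hb kb _ _]]].
  by rewrite (ring_discE hb (qr_e_zbasis f)) (ring_discE kb (cr_e_zbasis f)) qr_disc cr_disc.
exists Phi; split=> // [|f]; last exact: (disc f (pair_of_form f) (PhiE f)).
apply: inj_surj_bij => [S S'|S].
  have [f ->] := cls_surj S; have [g ->] := cls_surj S'.
  by rewrite !PhiE => /isoP/mp_iso_gl2_equiv/gl2P.
have [P ->] := cls_surj S; have [f hf] := pair_of_form_surj P.
by exists (cls gl2_equiv f); rewrite PhiE; apply/isoP.
Qed.
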